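(* Let $\mathcal{G}=(V,E)$ be a DAG and let $i,j\in V$ and $K\subseteq V$ be such that $K$ does not $d$-separate $i$ from $j$. For $\delta\in[0,1]$ let $\mathcal{M}_{i\perp_\delta j|K}$ denote the set of covariance matrices $\Sigma$ with $|\rho_{i,j\cdot K}|\le\delta$, and consider a node $l$ such that $K$ does not $d$-separate $i$ from $l$. Then $\mathcal{M}_\mathcal{G}\cap\mathcal{M}_{i\perp_\delta j|K}\subseteq\mathcal{M}_{i\perp_\delta l|K}$ for all $\delta\in[0,1]$ if and only if $\{j\}\cup K$ $d$-separates $i$ and $l$ in $\mathcal{G}$.
   Context: $\mathcal{M}_\mathcal{G}$ is the Gaussian DAG model: the set of matrices $(I-\Lambda)^{-T}\Omega(I-\Lambda)^{-1}$ with $\Lambda=(\lambda_{uv})$ real, $\lambda_{uv}=0$ unless $u\to v\in E$, and $\Omega$ positive diagonal. For a covariance matrix $\Sigma$, the conditional covariance is $\Sigma_{A,B\cdot C}=\Sigma_{A,B}-\Sigma_{A,C}\Sigma_{C,C}^{-1}\Sigma_{C,B}$ and the partial correlation is $\rho_{a,b\cdot C}=\sigma_{a,b\cdot C}/\sqrt{\sigma_{a,a\cdot C}\sigma_{b,b\cdot C}}$. $d$-separation: $C$ $d$-separates $a$ and $b$ if every path between them contains a non-collider in $C$ or a collider (node $k$ with $u\to k\leftarrow w$ on the path) that is not in $C$ and has no descendant in $C$. *)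

(* Defs.v *)
From HB Require Import structures.
From mathcomp Require Import all_boot all_order all_algebra.
From mathcomp Require Import reals.
Set Implicit Arguments. Unset Strict Implicit. Unset Printing Implicit Defensive.
Import Order.TTheory GRing.Theory Num.Theory.
Local Open Scope ring_scope.

Definition dag n (E : rel 'I_n) : Prop :=
  forall u v, E u v -> ~~ connect E v u.

Definition adj n (E : rel 'I_n) : rel 'I_n := fun u v => E u v || E v u.

(* On a path p = a :: s, interior position t (0 < t < size s) is blocked by C. *)
Definition blocked_at n (E : rel 'I_n) (C : {set 'I_n}) (a : 'I_n) (s : seq 'I_n)
    (t : nat) : bool :=
  let p := a :: s in
  let u := nth a p t.-1 in
  let k := nth a p t in
  let w := nth a p t.+1 in
  if E u k && E w k
  then (k \notin C) && [forall c in C, ~~ connect E k c]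
  else k \in C.

Definition dsep n (E : rel 'I_n) (C : {set 'I_n}) (a b : 'I_n) : Prop :=
  forall s : seq 'I_n, path (adj E) a s -> last a s = b -> uniq (a :: s) ->
    exists t, (0 < t < size s)%N /\ blocked_at E C a s t.

Definition gaussian_dag (R : realType) n (E : rel 'I_n) (S : 'M[R]_n) : Prop :=
  exists (L : 'M[R]_n) (w : 'rV[R]_n),
    (forall u v, ~~ E u v -> L u v = 0) /\ (forall u, 0 < w 0 u) /\
    S = invmx ((1%:M - L)^T) *m diag_mx w *m invmx (1%:M - L).

Definition covmx (R : realType) n (S : 'M[R]_n) : Prop :=
  S^T = S /\ forall x : 'cV[R]_n, x != 0 -> 0 < (x^T *m S *m x) 0 0.

Definition ccov (R : realType) n (S : 'M[R]_n) (C : {set 'I_n}) (a b : 'I_n) : R :=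
  S a b - ((\row_(k < #|C|) S a (enum_val k))
           *m invmx (\matrix_(k < #|C|, m < #|C|) S (enum_val k) (enum_val m))
           *m (\col_(k < #|C|) S (enum_val k) b)) 0 0.

Definition pcor (R : realType) n (S : 'M[R]_n) (C : {set 'I_n}) (a b : 'I_n) : R :=
  ccov S C a b / Num.sqrt (ccov S C a a * ccov S C b b).

Definition Mdelta (R : realType) n (a b : 'I_n) (C : {set 'I_n}) (delta : R)
    (S : 'M[R]_n) : Prop :=
  covmx S /\ `|pcor S C a b| <= delta.

(* Main.v *)
(* Write [c], [v], [y_i], [y_l] for cov(i,l | j,K), var(j | K) and the regression
   coefficients of i and l on j given K. Then cov(i,l | K) = c + y_i y_l v.

   If {j} u K d-separates i and l then c = 0, so rho_il.K = rho_ij.K rho_jl.K.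

   Otherwise c is generically nonzero. If j is a proper ancestor of some node t of
   {i, l} u K, through a child m, let x be an increment of the weight of j -> m and
   beta_u the total effect of m on u. Every X_u becomes X_u + x beta_u X_j: c does
   not move, y_i and y_l are affine in x, and v decays when x grows unless beta
   vanishes on K. Since rho_il.K^2 > rho_ij.K^2 amounts to
   c^2 + 2 c y_i y_l v > v y_i^2 var(l | j,K), and beta_t is generically nonzero,
   one can choose x so that y_i = 0, or y_l is the suitable value, or v is small.
   If j is no such ancestor, it can be isolated: rho_ij.K = 0 while rho_il.K is
   generically nonzero.

   Both directions between d-separation and vanishing of conditional covariances
   go by induction on the edges, cutting off a sink; genericity comes from
   covariances being rational functions along lines of edge weights. *)
Require Import Defs.
From HB Require Import structures.
From mathcomp Require Import all_boot all_order all_algebra.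
From mathcomp Require Import boolp reals.
From mathcomp Require Import zify ring lra.
Import Order.TTheory GRing.Theory Num.Theory.
Set Implicit Arguments. Unset Strict Implicit. Unset Printing Implicit Defensive.

(** * Active walks *)

(** The opening condition of a collider. As [connect] is reflexive, members of [C] satisfy it. *)
Definition anc n (E : rel 'I_n) (C : {set 'I_n}) (v : 'I_n) : bool :=
  [exists c in C, connect E v c].

(** All edges at [s] go, but the vertex stays, so that induction on the edges keeps the type ['I_n]
    fixed. *)
Definition del n (E : rel 'I_n) (s : 'I_n) : rel 'I_n :=
  fun u v => [&& E u v, u != s & v != s].

Definition sink n (E : rel 'I_n) (s : 'I_n) : Prop := forall v, ~~ E s v.

(* [oreach E C a d v]: some walk from [a] to [v], not necessarily simple, is
   active given [C]; [d] tells whether its last edge points into [v]. The empty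
   walk gets [d = false], which is harmless because [a] is never in [C]. *)
Inductive oreach n (E : rel 'I_n) (C : {set 'I_n}) (a : 'I_n) : bool -> 'I_n -> Prop :=
| oreach0 : oreach E C a false a
| oreach_dn d v w : oreach E C a d v -> v \notin C -> E v w -> oreach E C a true w
| oreach_up v w : oreach E C a false v -> v \notin C -> E w v -> oreach E C a false w
| oreach_col v w : oreach E C a true v -> anc E C v -> E w v -> oreach E C a false w.

Definition oconn n (E : rel 'I_n) (C : {set 'I_n}) (a b : 'I_n) : Prop :=
  exists d, oreach E C a d b.

Lemma ancP n (E : rel 'I_n) (C : {set 'I_n}) v :
  reflect (exists2 c, c \in C & connect E v c) (anc E C v).
Proof. exact: exists_inP. Qed.

Lemma anc_connect n (E : rel 'I_n) (C : {set 'I_n}) u v :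
  connect E u v -> anc E C v -> anc E C u.
Proof.
by move=> uv /ancP[c Cc vc]; apply/ancP; exists c => //; apply: connect_trans vc.
Qed.

Lemma dag_asym n (E : rel 'I_n) u v : dag E -> E u v -> E v u = false.
Proof. by move=> dE /dE; apply: contraNF => vu; apply: connect1. Qed.

Lemma dag_irr n (E : rel 'I_n) u : dag E -> E u u = false.
Proof. by move=> dE; apply/negP => uu; move: (dE _ _ uu); rewrite connect0. Qed.

Lemma connect_mono n (E E' : rel 'I_n) u v :
  subrel E' E -> connect E' u v -> connect E u v.
Proof. by move=> sE; apply: connect_sub => x y /sE; apply: connect1. Qed.

Lemma dag_sub n (E E' : rel 'I_n) : subrel E' E -> dag E -> dag E'.
Proof.
move=> sE dE u v /sE /dE; apply: contraNN; exact: connect_mono.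
Qed.

Lemma del_sub n (E : rel 'I_n) s : subrel (del E s) E.
Proof. by move=> u v /and3P[]. Qed.

Lemma sink_connect n (E : rel 'I_n) s v : sink E s -> connect E s v -> v = s.
Proof.
move=> sk /connectP[[|x p] /=]; first by move=> _ ->.
by rewrite (negPf (sk x)).
Qed.

Lemma connect_del n (E : rel 'I_n) j u v :
  connect E u v -> ~~ connect E j v -> connect (del E j) u v.
Proof.
move=> /connectP[p pp ->]; elim: p u pp => [|x p IH] u /=; first by rewrite connect0.
move=> /andP[ux px] nj; apply: connect_trans (IH _ px nj); apply: connect1.
have xl : connect E x (last x p) by apply/connectP; exists p.
rewrite /del ux /=; apply/andP; split; apply: contraNN nj => /eqP <- //.
by apply: connect_trans xl; apply: connect1.
Qed.

Lemma oreach_mono n (E E' : rel 'I_n) (C : {set 'I_n}) a d v :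
  subrel E' E -> oreach E' C a d v -> oreach E C a d v.
Proof.
move=> sE; elim=> {d v} [|d v w _ IH vC vw|v w _ IH vC vw|v w _ IH av wv].
- exact: oreach0.
- by apply: oreach_dn IH vC _; apply: sE.
- by apply: oreach_up IH vC _; apply: sE.
- apply: oreach_col IH _ (sE _ _ wv); case/ancP: av => c Cc vc.
  by apply/ancP; exists c => //; apply: connect_mono vc.
Qed.

(** The last edges of the first walk are moved one by one, reversed, onto the second. The side
    condition says that [v] is open in the concatenation, where it is a collider exactly when both
    walks arrive along an arrow into it. *)
Lemma oreach_join n (E : rel 'I_n) (C : {set 'I_n}) a b d d' v :
  oreach E C a d v -> oreach E C b d' v ->
  (if d && d' then anc E C v else v \notin C) -> oconn E C b a.
Proof.
move=> H; elim: H d' => {d v} [|d v w _ IH vC vw|v w _ IH vC wv|v w _ IH av wv] d' H' /=.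
- by exists d'.
- move=> cw; apply: (IH false); last by rewrite andbF.
  by case: d' H' cw => H' cw; [apply: oreach_col H' cw vw | apply: oreach_up H' cw vw].
- by move=> cw; apply: (IH true) => //=; apply: oreach_dn H' cw wv.
- by move=> cw; apply: (IH true) => //=; apply: oreach_dn H' cw wv.
Qed.

Lemma oconn_sym n (E : rel 'I_n) (C : {set 'I_n}) a b :
  b \notin C -> oconn E C a b -> oconn E C b a.
Proof.
move=> bC [d H]; apply: (oreach_join H (oreach0 E C b)).
by rewrite andbF.
Qed.

(** A walk that gets below [j] can never leave again: it could only turn upwards at a collider, and
    no descendant of [j] is an ancestor of [C]. As [b] is not below [j], the walk never gets
    there. *)
Lemma oconn_del n (E : rel 'I_n) (C : {set 'I_n}) j a b :
  ~~ connect E j a -> ~~ connect E j b -> ~~ anc E C j ->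
  oconn E C a b -> oconn (del E j) C a b.
Proof.
move=> ja jb jC [d H]; exists d.
(* Invariant along the walk: either it is below [j] and points downwards, or it has used no edge at
   [j]. *)
suff : (d /\ connect E j b) \/ (oreach (del E j) C a d b /\ ~~ connect E j b).
  by case=> [[_]|[]//]; rewrite (negPf jb).
have ne u : ~~ connect E j u -> u != j by apply: contraNneq => ->; rewrite connect0.
elim: H {jb} => {d b} [|d v w _ IH vC vw|v w _ IH vC wv|v w _ IH av wv].
- by right; split=> //; apply: oreach0.
- case: IH => [[_ jv]|[H jv]].
    by left; split=> //; apply: connect_trans jv _; apply: connect1.
  case: (boolP (connect E j w)) => [jw|jw]; [by left | right; split=> //].
  by apply: oreach_dn H vC _; rewrite /del vw !ne.
- case: IH => [[]//|[H jv]]; right.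
  have jw : ~~ connect E j w.
    by apply: contraNN jv => jw; apply: connect_trans jw _; apply: connect1.
  by split=> //; apply: oreach_up H vC _; rewrite /del wv !ne.
- have jv : ~~ connect E j v.
    by apply: contraNN jC => jv; apply: anc_connect av.
  have jw : ~~ connect E j w.
    by apply: contraNN jv => jw; apply: connect_trans jw _; apply: connect1.
  case: IH => [[_]|[H _]]; first by rewrite (negPf jv).
  right; split=> //; apply: oreach_col H _ _; last by rewrite /del wv !ne.
  case/ancP: av => c Cc vc; apply/ancP; exists c => //; apply: connect_del => //.
  by apply: contraNN jC => jc; apply/ancP; exists c.
Qed.

(** An active walk from [a] enters [s] through a parent, [s] not being used before and not helping
    to open colliders. *)
Definition feeds n (E : rel 'I_n) (C : {set 'I_n}) (s a : 'I_n) : Prop :=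
  exists q, [/\ E q s, q \notin C & oconn (del E s) (C :\ s) a q].

(** Follow a directed path from [v] down to [s]. If it meets [C] before [s], then [v] remains an
    ancestor of [C :\ s]; otherwise the walk extends along it to a parent of [s]. *)
Lemma feeds_descend n (E : rel 'I_n) (C : {set 'I_n}) s a d v :
  dag E -> sink E s -> v != s -> connect E v s ->
  oreach (del E s) (C :\ s) a d v ->
  feeds E C s a \/ anc (del E s) (C :\ s) v.
Proof.
move=> dE sk vs /connectP[p]; elim: p d v vs => [|x p IH] d v vs /=.
  by move=> _ es; rewrite es eqxx in vs.
move=> /andP[vx px] es H.
case: (boolP (v \in C)) => vC.
  by right; apply/ancP; exists v; rewrite ?inE ?vs ?connect0.
case: (eqVneq x s) => [xs|xs].
  by left; exists v; rewrite -xs; split=> //; rewrite xs; exists d.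
have dvx : del E s v x by rewrite /del vx vs.
have [] := IH true x xs px es; [|by left|].
  by apply: oreach_dn H _ dvx; rewrite !inE negb_and vC orbT.
by move=> ax; right; apply: anc_connect ax; apply: connect1.
Qed.

(** A sink is entered only by an arrow into it, so the first visit to [s] gives [feeds]. A collider
    opened through [s] alone is handled by [feeds_descend]. *)
Lemma oreach_sink n (E : rel 'I_n) (C : {set 'I_n}) s a d v :
  dag E -> sink E s -> a != s -> oreach E C a d v ->
  feeds E C s a \/ (v != s /\ oreach (del E s) (C :\ s) a d v).
Proof.
move=> dE sk as_; elim=> {d v} [|d v w _ IH vC vw|v w _ IH vC wv|v w _ IH av wv].
- by right; split=> //; apply: oreach0.
- case: IH => [|[vs H]]; first by left.
  case: (eqVneq w s) => [ws|ws].
    by left; exists v; rewrite -ws; split=> //; rewrite ws; exists d.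
  right; split=> //; apply: oreach_dn H _ _; last by rewrite /del vw vs.
  by rewrite !inE negb_and vC orbT.
- case: IH => [|[vs H]]; first by left.
  have ws : w != s by apply: contraTneq wv => ->; apply: sk.
  right; split=> //; apply: oreach_up H _ _; last by rewrite /del wv vs ws.
  by rewrite !inE negb_and vC orbT.
- case: IH => [|[vs H]]; first by left.
  have ws : w != s by apply: contraTneq wv => ->; apply: sk.
  have [|av'] : feeds E C s a \/ anc (del E s) (C :\ s) v; last first.
  + by right; split=> //; apply: oreach_col H av' _; rewrite /del wv vs ws.
  + by left.
  case/ancP: av => c Cc vc; case: (eqVneq c s) => [cs|cs].
    by apply: feeds_descend H => //; rewrite -cs.
  right; apply/ancP; exists c; rewrite ?inE ?cs //; apply: connect_del => //.
  by apply: contraNN cs => /(sink_connect sk) ->.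
Qed.

Lemma oreach_restore n (E : rel 'I_n) (C : {set 'I_n}) s a d v :
  a != s -> oreach (del E s) (C :\ s) a d v -> v != s /\ oreach E C a d v.
Proof.
move=> as_; have nC u : u != s -> u \notin C :\ s -> u \notin C.
  by move=> us; rewrite !inE us.
elim=> {d v} [|d v w _ [vs IH] vC|v w _ [vs IH] vC|v w _ [vs IH] av].
- by split=> //; apply: oreach0.
- by case/and3P=> vw _ ->; split=> //; apply: oreach_dn IH (nC _ vs vC) vw.
- by case/and3P=> wv -> _; split=> //; apply: oreach_up IH (nC _ vs vC) wv.
- case/and3P=> wv -> _; split=> //; apply: oreach_col IH _ wv.
  case/ancP: av => c; rewrite !inE => /andP[_ Cc] vc; apply/ancP; exists c => //.
  by apply: connect_mono vc; apply: del_sub.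
Qed.

(** A conditioned sink can be passed only as a collider. The two alternatives match the two terms of
    [ccov_setU1] when [s] is removed from the conditioning set. *)
Lemma oconn_sink_in n (E : rel 'I_n) (C : {set 'I_n}) s a b :
  dag E -> sink E s -> s \in C -> a \notin C -> b \notin C ->
  oconn E C a b <->
  oconn (del E s) (C :\ s) a b \/ (feeds E C s a /\ feeds E C s b).
Proof.
move=> dE sk sC aC bC.
have ne u : u \notin C -> u != s by apply: contraNneq => ->.
have nC u : u \notin C -> u \notin C :\ s by rewrite !inE negb_and => ->; rewrite orbT.
split=> [[d H]|].
  have [fa|[_ H']] := oreach_sink dE sk (ne _ aC) H; last by left; exists d.
  have [d' /(oreach_sink dE sk (ne _ bC))[fb|[_ H']]] := oconn_sym bC (ex_intro _ d H).
    by right.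
  by left; apply: oconn_sym (nC _ aC) _; exists d'.
case=> [[d /(oreach_restore (ne _ aC))[_ H]]|]; first by exists d.
have to_s u : u \notin C -> feeds E C s u -> oreach E C u true s.
  move=> uC [q [qs qC [d /(oreach_restore (ne _ uC))[_ H]]]].
  exact: oreach_dn H qC qs.
case=> [/(to_s _ aC) Ha /(to_s _ bC) Hb].
by apply: (oreach_join Hb Ha) => /=; apply/ancP; exists s.
Qed.

(** Counterpart for walks of the linear formula [ccov_sink]. *)
Lemma oconn_sink_end n (E : rel 'I_n) (C : {set 'I_n}) s a :
  dag E -> sink E s -> s \notin C -> a != s -> oconn E C a s <->
  exists p, [/\ E p s, p \notin C & oconn (del E s) C a p].
Proof.
move=> dE sk sC as_; split=> [[d H]|[p [ps pC [d H]]]]; last first.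
  by exists true; apply: oreach_dn pC ps; apply: oreach_mono H; apply: del_sub.
have nos u : u != s -> ~~ connect E s u.
  by apply: contraNN => /(sink_connect sk) ->.
have sC' : ~~ anc E C s.
  by apply/negP => /ancP[c Cc /(sink_connect sk) cs]; rewrite -cs Cc in sC.
suff gen d' z : oreach E C a d' z -> z = s ->
    exists p, [/\ E p s, p \notin C & oconn (del E s) C a p] by apply: gen H _.
case=> {d' z H} [|d' v w H vC vw|v w _ _ wv|v w _ _ wv].
- by move=> sa; rewrite sa eqxx in as_.
- move=> ws; rewrite ws in vw; exists v; split=> //.
  apply: oconn_del; rewrite ?nos //; last by exists d'.
  by apply: contraTneq vw => ->; rewrite dag_irr.
- by move=> ws; rewrite ws (negPf (sk v)) in wv.
- by move=> ws; rewrite ws (negPf (sk v)) in wv.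
Qed.

(** * From active walks to simple active paths *)

Definition open3 n (E : rel 'I_n) (C : {set 'I_n}) (u k w : 'I_n) : bool :=
  if E u k && E w k then anc E C k else k \notin C.

(** A vertex function with a length, instead of a list, makes cutting out a loop a shift of indices;
    values beyond [N] are irrelevant. *)
Definition walk n (E : rel 'I_n) (C : {set 'I_n}) (f : nat -> 'I_n) (N : nat) : Prop :=
  (forall t, t < N -> adj E (f t) (f t.+1)) /\
  (forall t, 0 < t < N -> open3 E C (f t.-1) (f t) (f t.+1)).

Lemma blocked_atE n (E : rel 'I_n) (C : {set 'I_n}) a s t :
  blocked_at E C a s t =
  ~~ open3 E C (nth a (a :: s) t.-1) (nth a (a :: s) t) (nth a (a :: s) t.+1).
Proof.
rewrite /blocked_at /open3; set k := nth _ _ t.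
case: ifP => _; last by rewrite negbK.
have -> : [forall c in C, ~~ connect E k c] = ~~ anc E C k.
  by rewrite negb_exists_in.
rewrite andb_idl // => nk; apply: contraNN nk => kC.
by apply/ancP; exists k.
Qed.

Lemma walk_oreach n (E : rel 'I_n) (C : {set 'I_n}) (f : nat -> 'I_n) N :
  dag E -> f 0 \notin C -> walk E C f N -> oconn E C (f 0) (f N).
Proof.
move=> dE f0 [fa fo].
suff gen t : t <= N -> exists2 d, oreach E C (f 0) d (f t) &
    0 < t -> d = E (f t.-1) (f t).
  by have [d H _] := gen N (leqnn N); exists d.
elim: t => [|t IH] tN; first by exists false => //; apply: oreach0.
have [d H dt] := IH (ltnW tN).
have [ud|du] := orP (fa t tN); last first.
  have ud := dag_asym dE du.
  exists false; last by rewrite /= ud.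
  case: t H dt {IH} tN du {ud} => [|t] H dt tN du.
    exact: oreach_up (oreach0 E C (f 0)) f0 du.
  have := fo t.+1 tN; rewrite /open3 /= du -dt // andbT.
  by case: d H {dt} => H c; [apply: oreach_col H c du | apply: oreach_up H c du].
exists true; last by rewrite /= ud.
apply: (oreach_dn H _ ud); case: t dt {IH H} tN ud => [|t] dt tN ud; first exact: f0.
by have := fo t.+1 tN; rewrite /open3 /= (dag_asym dE ud) andbF.
Qed.

(** The walk is listed backwards, from [v] to [a], so that each constructor of [oreach] prepends a
    vertex. The last clause keeps the orientation of the edge at [v], which decides whether [v]
    becomes a collider. *)
Lemma oreach_walk n (E : rel 'I_n) (C : {set 'I_n}) a d v :
  dag E -> oreach E C a d v -> exists (f : nat -> 'I_n) (N : nat),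
    [/\ walk E C f N, f 0 = v, f N = a &
        if N is 0 then d = false else d = E (f 1) (f 0)].
Proof.
move=> dE.
pose cns w f t : 'I_n := if t is t'.+1 then f t' else w.
have step f N w : walk E C f N -> adj E w (f 0) ->
    (0 < N -> open3 E C w (f 0) (f 1)) -> walk E C (cns w f) N.+1.
  move=> [fa fo] aw ow; split=> [[|t] tN|[|[|t]] tN]; rewrite /= in tN *.
  - exact: aw.
  - exact: fa.
  - by [].
  - exact: ow.
  - exact: (fo t.+1).
elim=> {d v} [|d v w _ [f [N [W f0 fN dN]]] vC vw|v w _ [f [N [W f0 fN dN]]] vC wv
            |v w _ [f [N [W f0 fN dN]]] av wv].
- by exists (fun=> a), 0; split=> //; split=> t; rewrite ?ltn0 ?andbF.
- exists (cns w f), N.+1; split=> //=; last by rewrite f0 vw.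
  apply: step => // [|N0]; first by rewrite /adj f0 vw orbT.
  by rewrite /open3 f0 (dag_asym dE vw).
- exists (cns w f), N.+1; split=> //=; last by rewrite f0 (dag_asym dE wv).
  apply: step => // [|N0]; first by rewrite /adj f0 wv.
  by case: N N0 dN {W fN} => // N _; rewrite /open3 f0 wv => <-.
- exists (cns w f), N.+1; split=> //=; last by rewrite f0 (dag_asym dE wv).
  apply: step => // [|N0]; first by rewrite /adj f0 wv.
  by case: N N0 dN {W fN} => // N _; rewrite /open3 f0 wv => <-.
Qed.

(* Leaving [k] downwards and coming back to it forces, by acyclicity, a collider
   below [k] on the way. *)
Lemma loop_anc n (E : rel 'I_n) (C : {set 'I_n}) f N x y :
  dag E -> walk E C f N -> x < y -> y <= N -> f x = f y ->
  E (f x) (f x.+1) -> anc E C (f x).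
Proof.
move=> dE [fa fo] xy yN fxy xx1.
suff gen r : x + r < y -> anc E C (f x) \/
    (connect E (f x) (f (x + r)) /\ E (f (x + r)) (f (x + r).+1)).
  have [|//|[c e]] := gen (y - x.+1); first lia.
  have ey : (x + (y - x.+1)).+1 = y by lia.
  by rewrite ey -fxy in e; have := dE _ _ e; rewrite c.
elim: r => [|r IH] rl; first by right; rewrite addn0 connect0.
have [|A|[c e]] := IH; [lia | by left |].
rewrite addnS in rl *.
have c' : connect E (f x) (f (x + r).+1).
  by apply: (connect_trans c); apply: connect1.
have := fo (x + r).+1; rewrite /open3 /= e /=.
have := fa (x + r).+1 ltac:(lia); rewrite /adj.
case: (E (f (x + r).+2) (f (x + r).+1)) => /=.
  by move=> _ /(_ ltac:(lia)) av; left; apply: anc_connect av.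
by rewrite orbF => e' _; right.
Qed.

(** Only the junction [k = f x = f y] needs care. If it is no collider after the cut, one of its two
    arms does not point into [k], and the old triple with that arm gave [k \notin C]. If it is one,
    either the triple at [x] was already a collider, or the loop left [k] downwards and [loop_anc]
    applies. *)
Lemma walk_cut n (E : rel 'I_n) (C : {set 'I_n}) f N x y :
  dag E -> walk E C f N -> x < y -> y <= N -> f x = f y ->
  walk E C (fun t => if t <= x then f t else f (t + (y - x))) (N - (y - x)).
Proof.
move=> dE W xy yN fxy; have [fa fo] := W; split=> t tN.
  case: (ltngtP t x) => tx.
  - by apply: fa; lia.
  - by have -> : t.+1 + (y - x) = (t + (y - x)).+1 by []; apply: fa; lia.
  - by rewrite tx fxy; have -> : x.+1 + (y - x) = y.+1 by [lia]; apply: fa; lia.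
case: (ltngtP t x) => tx.
- by have -> : t.-1 <= x by [lia]; apply: fo; lia.
- have -> : (if t.-1 <= x then f t.-1 else f (t.-1 + (y - x))) = f (t + (y - x)).-1.
    case: ifP => tx'; last by congr f; lia.
    have -> : (t + (y - x)).-1 = y by lia.
    by rewrite -fxy; congr f; lia.
  by have -> : t.+1 + (y - x) = (t + (y - x)).+1 by []; apply: fo; lia.
have -> : t.-1 <= x by lia.
have -> : t.+1 + (y - x) = y.+1 by lia.
have yN' : y < N by lia.
have ox := fo x ltac:(lia); have oy := fo y ltac:(lia).
have ax := fa x ltac:(lia); have ay := fa y yN'.
rewrite tx; move: ox oy; rewrite /open3 -fxy; rewrite -fxy in ay.
have [uk|uk] := boolP (E (f x.-1) (f x)); last by [].
have [wk|wk] := boolP (E (f y.+1) (f x)); last by rewrite andbF.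
have [//|w'k] := boolP (E (f x.+1) (f x)) => _ _.
by move: ax; rewrite /adj (negPf w'k) orbF; apply: loop_anc W xy yN fxy.
Qed.

Lemma walk_simple n (E : rel 'I_n) (C : {set 'I_n}) f N :
  dag E -> walk E C f N -> exists g M,
    [/\ walk E C g M, g 0 = f 0, g M = f N & uniq (mkseq g M.+1)].
Proof.
move=> dE; elim/ltn_ind: N f => N IH f W.
case: (boolP (uniq (mkseq f N.+1))) => [u|/(uniqPn (f 0))]; first by exists f, N.
move=> [x [y []]]; rewrite size_mkseq => xy yN.
rewrite !nth_mkseq //; last lia.
move=> fxy; have [|g [M [gW g0 gM gu]]] := IH _ _ _ (walk_cut dE W xy yN fxy).
  lia.
exists g, M; split=> //; rewrite gM.
case: ifP => NX; last by congr f; lia.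
have <- : y = N by lia.
by rewrite -fxy; congr f; lia.
Qed.

(** [dsep] speaks of simple paths, [oconn] of arbitrary walks; [walk_simple] bridges the gap. *)
Lemma dsep_oconn n (E : rel 'I_n) (C : {set 'I_n}) a b :
  dag E -> a \notin C -> b \notin C -> dsep E C a b <-> ~ oconn E C a b.
Proof.
move=> dE aC bC; split=> [ds [d H]|nc s ps ls us].
  (* The connection is reversed first because [oreach_walk] lists walks backwards. *)
  have [d' /(oreach_walk dE)[f [N [W f0 fN _]]]] := oconn_sym bC (ex_intro _ d H).
  have [g [M [[ga go] g0 gM gu]]] := walk_simple dE W.
  have gm : mkseq g M.+1 = a :: mkseq (g \o succn) M.
    by rewrite -f0 -g0 /mkseq /= -[1]/(1 + 0) iotaDl -map_comp.
  have gn t : t <= M -> nth a (a :: mkseq (g \o succn) M) t = g t.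
    by move=> tM; rewrite -gm nth_mkseq.
  have [|||t [tM]] := ds (mkseq (g \o succn) M); last 1 first.
  - rewrite size_mkseq in tM.
    by rewrite blocked_atE !gn; [rewrite go | lia..].
  - apply/(pathP a) => t; rewrite size_mkseq => tM.
    by rewrite nth_mkseq // (gn t (ltnW tM)); apply: ga.
  - by rewrite (last_nth a) size_mkseq gn // gM.
  - by rewrite -gm.
case: (boolP (has (fun t => (0 < t) && blocked_at E C a s t) (iota 0 (size s)))).
  by case/hasP=> t; rewrite mem_iota /= add0n => ts /andP[t0 bt]; exists t; rewrite t0 ts.
move=> /hasPn nb; case: nc; rewrite -ls (last_nth a).
apply: (@walk_oreach n E C (nth a (a :: s)) (size s)) => //; split=> t tN.
  exact: (pathP a ps).
case/andP: tN => t0 ts; have := nb t; rewrite mem_iota /= add0n ts t0 => /(_ isT).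
by rewrite blocked_atE negbK.
Qed.

(** * Conditional covariances and regression residuals *)

Local Open Scope ring_scope.

(** The covariance of the linear combinations of the variables with coefficient vectors [x] and
    [y]. *)
Definition qform (R : realType) n (S : 'M[R]_n) (x y : 'cV[R]_n) : R :=
  (x^T *m S *m y) 0 0.

(* [r] is the coordinate vector of the residual of [X_a] in its regression on [X_C]. *)
Definition is_res (R : realType) n (S : 'M[R]_n) (C : {set 'I_n}) (a : 'I_n)
    (r : 'cV[R]_n) : Prop :=
  (forall v, v \notin C -> r v 0 = (v == a)%:R) /\
  (forall c, c \in C -> (S *m r) c 0 = 0).

(** Selecting coordinates by a matrix turns the blocks in [ccov] into products, to which matrix
    algebra applies. *)
Definition selmx (R : realType) n (C : {set 'I_n}) : 'M[R]_(#|C|, n) :=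
  \matrix_(k, v) (enum_val k == v)%:R.

Lemma selmx_mul (R : realType) n (C : {set 'I_n}) m (A : 'M[R]_(n, m)) k v :
  (selmx R C *m A) k v = A (enum_val k) v.
Proof.
rewrite mxE (bigD1 (enum_val k)) //= mxE eqxx mul1r big1 ?addr0 // => u.
by rewrite mxE eq_sym => /negPf ->; rewrite mul0r.
Qed.

Lemma mul_selmx (R : realType) n (C : {set 'I_n}) m (A : 'M[R]_(m, n)) k v :
  (A *m (selmx R C)^T) v k = A v (enum_val k).
Proof. by rewrite -[A]trmxK -trmx_mul mxE selmx_mul !mxE. Qed.

Lemma selmxK (R : realType) n (C : {set 'I_n}) : selmx R C *m (selmx R C)^T = 1%:M.
Proof.
by apply/matrixP => k k'; rewrite mul_selmx !mxE (inj_eq enum_val_inj).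
Qed.

Lemma selmx_out (R : realType) n (C : {set 'I_n}) m (A : 'M[R]_(#|C|, m)) v k :
  v \notin C -> ((selmx R C)^T *m A) v k = 0.
Proof.
move=> vC; rewrite mxE big1 // => t _; rewrite !mxE.
case: eqP => [tv|_]; last by rewrite mul0r.
by rewrite -tv enum_valP in vC.
Qed.

Lemma qformE (R : realType) n (S : 'M[R]_n) x y :
  qform S x y = \sum_v x v 0 * (S *m y) v 0.
Proof. by rewrite /qform -mulmxA mxE; apply: eq_bigr => v _; rewrite mxE. Qed.

Lemma qformC (R : realType) n (S : 'M[R]_n) x y : S^T = S -> qform S x y = qform S y x.
Proof.
move=> Ss; rewrite /qform.
have -> : x^T *m S *m y = (y^T *m S *m x)^T by rewrite !trmx_mul Ss trmxK mulmxA.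
by rewrite mxE.
Qed.

(** A kernel vector of the block, extended by zeros, would be a nonzero combination of variance
    zero. *)
Lemma covmx_sub_unit (R : realType) n (S : 'M[R]_n) (C : {set 'I_n}) :
  covmx S -> selmx R C *m S *m (selmx R C)^T \in unitmx.
Proof.
move=> [_ Sp]; set P := selmx R C.
rewrite -row_free_unit -kermx_eq0; apply/eqP/eqP/rowV0P => y /sub_kermxP yS.
have x0 : (y *m P)^T = 0.
  apply/eqP/contraT => /Sp; rewrite trmxK trmx_mul.
  have -> : y *m P *m S *m (P^T *m y^T) = y *m (P *m S *m P^T) *m y^T.
    by rewrite !mulmxA.
  by rewrite yS mul0mx mxE ltxx.
have : y *m P *m P^T = 0 by rewrite -[y *m P]trmxK x0 trmx0 mul0mx.
by rewrite -mulmxA selmxK mulmx1.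
Qed.

Lemma ccovE (R : realType) n (S : 'M[R]_n) (C : {set 'I_n}) a b :
  ccov S C a b = (S - S *m (selmx R C)^T *m
    invmx (selmx R C *m S *m (selmx R C)^T) *m selmx R C *m S) a b.
Proof.
rewrite /ccov; set P := selmx R C.
have -> : \matrix_(k, m) S (enum_val k) (enum_val m) = P *m S *m P^T.
  by apply/matrixP => k m; rewrite mul_selmx selmx_mul !mxE.
have -> : \row_k S a (enum_val k) = row a (S *m P^T).
  by apply/rowP => k; rewrite [RHS]mxE mul_selmx mxE.
have -> : \col_k S (enum_val k) b = col b (P *m S).
  by apply/colP => k; rewrite [RHS]mxE selmx_mul mxE.
have row_col (A : 'M[R]_(n, #|C|)) B (D : 'M[R]_(#|C|, n)) :
    (row a A *m B *m col b D) 0 0 = (A *m B *m D) a b.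
  rewrite -row_mul mxE [RHS]mxE; apply: eq_bigr => k _.
  by rewrite [row _ _ _ _]mxE [col _ _ _ _]mxE.
by rewrite row_col [RHS]mxE; congr (_ + _); rewrite [RHS]mxE !mulmxA.
Qed.

Lemma res_exists (R : realType) n (S : 'M[R]_n) (C : {set 'I_n}) a :
  covmx S -> exists2 r, is_res S C a r & forall b, ccov S C b a = (S *m r) b 0.
Proof.
move=> /(covmx_sub_unit C); set P := selmx R C => Pu.
(* The unit vector at [a] minus the least squares coefficients on [C]. *)
exists (delta_mx a 0 - P^T *m (invmx (P *m S *m P^T) *m (P *m S *m delta_mx a 0)));
    last first.
  move=> b; rewrite ccovE -/P mulmxBr !mulmxA -mulmxBl.
  by rewrite -colE [RHS]mxE.
split=> [v vC|c cC].
  rewrite mxE [X in _ + X]mxE selmx_out // oppr0 addr0 mxE eqxx andbT //.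
have -> : c = enum_val (enum_rank_in cC c) by rewrite enum_rankK_in.
rewrite -[LHS]selmx_mul -/P mulmxA mulmxBr !mulmxA mulmxV // mul1mx subrr mxE //.
Qed.

Lemma qform_ge0 (R : realType) n (S : 'M[R]_n) x : covmx S -> 0 <= qform S x x.
Proof.
move=> [_ Sp]; have [->|/Sp /ltW //] := eqVneq x 0.
by rewrite /qform mulmx0 mxE.
Qed.

Lemma qform_supp (R : realType) n (S : 'M[R]_n) (C : {set 'I_n}) (x y : 'cV[R]_n) :
  (forall v, v \notin C -> x v 0 = 0) -> (forall c, c \in C -> (S *m y) c 0 = 0) ->
  qform S x y = 0.
Proof.
move=> x0 y0; rewrite qformE big1 // => v _.
by have [/y0 ->|/x0 ->] := boolP (v \in C); rewrite ?mulr0 ?mul0r.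
Qed.

(** The difference of two residuals lies in the span of the [C] coordinates and is uncorrelated with
    them, hence has variance zero. *)
Lemma res_unique (R : realType) n (S : 'M[R]_n) (C : {set 'I_n}) a r r' :
  covmx S -> is_res S C a r -> is_res S C a r' -> r = r'.
Proof.
move=> [_ Sp] [r1 r2] [r1' r2']; apply/eqP; rewrite -subr_eq0.
apply/contraT => /Sp; rewrite -/(qform _ _ _) (@qform_supp _ _ _ C) ?ltxx //.
- by move=> v vC; rewrite !mxE r1 // r1' // subrr.
- by move=> c cC; rewrite mulmxBr [LHS]mxE [X in _ + X]mxE r2 // r2' // subrr.
Qed.

Lemma ccov_res (R : realType) n (S : 'M[R]_n) (C : {set 'I_n}) a r b :
  covmx S -> is_res S C a r -> ccov S C b a = (S *m r) b 0.
Proof.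
move=> cS rr; have [r' rr' ->] := res_exists C a cS.
by rewrite (res_unique cS rr rr').
Qed.

Lemma ccov_in (R : realType) n (S : 'M[R]_n) (C : {set 'I_n}) a b :
  covmx S -> b \in C -> ccov S C b a = 0.
Proof. by move=> cS bC; have [r [_ r0] ->] := res_exists C a cS; apply: r0. Qed.

(* Two vectors with the same coordinates outside [C] differ only along [X_C]. *)
Lemma qform_res (R : realType) n (S : 'M[R]_n) (C : {set 'I_n}) a r b (u : 'cV[R]_n) :
  covmx S -> is_res S C a r -> (forall v, v \notin C -> u v 0 = (v == b)%:R) ->
  b \notin C -> qform S u r = ccov S C b a.
Proof.
move=> cS rr u1 bC; rewrite (ccov_res _ cS rr) qformE (bigD1 b) //=.
rewrite u1 // eqxx mul1r big1 ?addr0 // => v vb.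
have [vC|vC] := boolP (v \in C); first by rewrite rr.2 ?mulr0.
by rewrite u1 // (negPf vb) mul0r.
Qed.

Lemma ccovC (R : realType) n (S : 'M[R]_n) (C : {set 'I_n}) a b :
  covmx S -> a \notin C -> b \notin C -> ccov S C a b = ccov S C b a.
Proof.
move=> cS aC bC; have [ra Ra _] := res_exists C a cS.
have [rb Rb _] := res_exists C b cS.
rewrite -(qform_res cS Rb Ra.1 aC) -(qform_res cS Ra Rb.1 bC) qformC //.
by case: cS.
Qed.

Lemma ccov_gt0 (R : realType) n (S : 'M[R]_n) (C : {set 'I_n}) a :
  covmx S -> a \notin C -> 0 < ccov S C a a.
Proof.
move=> cS aC; have [r rr _] := res_exists C a cS.
rewrite -(qform_res cS rr rr.1 aC); apply: cS.2.
by apply: contraTneq aC => r0; have := rr.1 a; rewrite r0 mxE eqxx;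
  case: (a \in C) => // /(_ isT) /esym /eqP; rewrite oner_eq0.
Qed.

(** The residual minimises the variance: by orthogonality, the excess of [u] over it is the variance
    of [u - r]. *)
Lemma ccov_le_qform (R : realType) n (S : 'M[R]_n) (C : {set 'I_n}) a (u : 'cV[R]_n) :
  covmx S -> a \notin C -> (forall v, v \notin C -> u v 0 = (v == a)%:R) ->
  ccov S C a a <= qform S u u.
Proof.
move=> cS aC u1; have [r rr _] := res_exists C a cS.
have /= := qform_ge0 (u - r) cS.
have -> : qform S (u - r) (u - r) = qform S u u - qform S r u.
  rewrite /qform mulmxBr linearB /= !mulmxBl.
  rewrite [X in X = _]mxE [X in _ + X = _]mxE.
  have -> : ((u^T *m S *m r) - (r^T *m S *m r)) 0 0 = 0.
    rewrite mxE [X in _ + X]mxE -!/(qform _ _ _).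
    by rewrite (qform_res cS rr u1) // (qform_res cS rr rr.1) // subrr.
  by rewrite subr0 mxE [X in _ + X]mxE.
by rewrite [qform S r u]qformC ?cS.1 // (qform_res cS rr u1) // subr_ge0.
Qed.

(** One Gram-Schmidt step: the residual of [a] is regressed on that of [j]. *)
Lemma res_setU1 (R : realType) n (S : 'M[R]_n) (C : {set 'I_n}) j a ra rj :
  covmx S -> j \notin C -> a != j -> is_res S C a ra -> is_res S C j rj ->
  is_res S (j |: C) a (ra - (ccov S C j a / ccov S C j j) *: rj).
Proof.
move=> cS jC aj Ra Rj; have jj := ccov_gt0 cS jC; split=> [v|c].
  rewrite !inE negb_or => /andP[vj vC].
  by rewrite !mxE Ra.1 // Rj.1 // (negPf vj) mulr0 subr0.
rewrite mulmxBr -scalemxAr !mxE -/((S *m ra) c 0) => cjC.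
have -> : \sum_k S c k * ra k 0 = ccov S C c a by rewrite (ccov_res _ cS Ra) mxE.
have -> : \sum_k S c k * rj k 0 = ccov S C c j by rewrite (ccov_res _ cS Rj) mxE.
move: cjC; rewrite !inE => /orP[/eqP ->|cC].
  by rewrite divfK ?subrr // gt_eqF.
by rewrite (ccov_in a cS cC) (ccov_in j cS cC) mulr0 subr0.
Qed.

Lemma ccov_setU1 (R : realType) n (S : 'M[R]_n) (C : {set 'I_n}) j a b :
  covmx S -> j \notin C -> a != j ->
  ccov S (j |: C) b a = ccov S C b a - ccov S C b j * ccov S C j a / ccov S C j j.
Proof.
move=> cS jC aj; have [ra Ra Ea] := res_exists C a cS.
have [rj Rj Ej] := res_exists C j cS.
rewrite (ccov_res _ cS (res_setU1 cS jC aj Ra Rj)).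
rewrite mulmxBr -scalemxAr mxE [X in _ + X]mxE [X in _ - X]mxE -Ea -Ej.
by congr (_ - _); rewrite mulrC mulrA.
Qed.

(** Up to sign, the coordinate at [j] of the residual is the regression coefficient of [a] on [j]
    given [C]. *)
Lemma ccov_res_coord (R : realType) n (S : 'M[R]_n) (C : {set 'I_n}) j a r :
  covmx S -> j \notin C -> a \notin C -> a != j -> is_res S (j |: C) a r ->
  ccov S C j a = - r j 0 * ccov S C j j.
Proof.
move=> cS jC aC aj Rr; have [ra Ra _] := res_exists C a cS.
have [rj Rj _] := res_exists C j cS.
rewrite (res_unique cS Rr (res_setU1 cS jC aj Ra Rj)) !mxE.
rewrite Ra.1 // Rj.1 // eqxx eq_sym (negPf aj) mulr1 sub0r opprK divfK //.
by rewrite gt_eqF // ccov_gt0.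
Qed.

Lemma eq_ccov (R : realType) n (S S' : 'M[R]_n) (C : {set 'I_n}) a b :
  (forall u v, u \in a |: C -> v \in b |: C -> S u v = S' u v) ->
  ccov S C a b = ccov S' C a b.
Proof.
move=> eS; have inU x (k : 'I_#|C|) : enum_val k \in x |: C by rewrite in_setU1 enum_valP orbT.
rewrite /ccov eS ?inE ?eqxx //; congr (_ - (_ *m invmx _ *m _) 0 0).
- by apply/rowP => k; rewrite !mxE eS // !inE eqxx.
- by apply/matrixP => k m; rewrite !mxE eS.
- by apply/colP => k; rewrite !mxE eS // !inE eqxx.
Qed.

(** * Covariance matrices of Gaussian DAG models *)

Definition supported (R : realType) n (E : rel 'I_n) (L : 'M[R]_n) : Prop :=
  forall u v, ~~ E u v -> L u v = 0.

(** The matrix of total effects: entry [u v] sums the weight products over the directed paths from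
    [u] to [v]. *)
Definition toteff (R : realType) n (L : 'M[R]_n) : 'M[R]_n := invmx (1%:M - L).

Definition covdag (R : realType) n (L : 'M[R]_n) (w : 'rV[R]_n) : 'M[R]_n :=
  invmx ((1%:M - L)^T) *m diag_mx w *m invmx (1%:M - L).

Lemma supported_sub (R : realType) n (E E' : rel 'I_n) (L : 'M[R]_n) :
  subrel E' E -> supported E' L -> supported E L.
Proof. by move=> sE sL u v uv; apply: sL; apply: contraNN uv; apply: sE. Qed.

(** A parent has strictly fewer ancestors than its child. *)
Lemma dag_ind n (E : rel 'I_n) (P : 'I_n -> Prop) :
  dag E -> (forall v, (forall u, E u v -> P u) -> P v) -> forall v, P v.
Proof.
move=> dE IH v; have [m] := ubnP #|[set u | connect E u v]|.
elim: m v => // m IHm v vm; apply: IH => u uv; apply: IHm.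
rewrite -ltnS; apply: leq_trans vm; rewrite ltnS; apply/proper_card/properP; split.
  apply/subsetP => x; rewrite !inE => xu; apply: connect_trans xu _.
  exact: connect1.
by exists v; rewrite !inE ?connect0 // dE.
Qed.

(** A row vector fixed by [L] vanishes at a vertex once it vanishes at its parents. *)
Lemma unit_1sub (R : realType) n (E : rel 'I_n) (L : 'M[R]_n) :
  dag E -> supported E L -> 1%:M - L \in unitmx.
Proof.
move=> dE sL; rewrite -row_free_unit -kermx_eq0; apply/eqP/eqP/rowV0P.
move=> y /sub_kermxP; rewrite mulmxBr mulmx1 => /eqP; rewrite subr_eq0 => /eqP yL.
apply/rowP => v; rewrite mxE; move: v; apply: (dag_ind dE) => v IH.
rewrite yL mxE big1 // => u _; have [/IH ->|/sL ->] := boolP (E u v).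
  by rewrite mul0r.
by rewrite mulr0.
Qed.

Lemma toteff_rec (R : realType) n (E : rel 'I_n) (L : 'M[R]_n) u v :
  dag E -> supported E L ->
  toteff L u v = (u == v)%:R + \sum_p toteff L u p * L p v.
Proof.
move=> dE sL; have := mulVmx (unit_1sub dE sL); rewrite -/(toteff L) mulmxBr mulmx1.
by move=> /eqP; rewrite subr_eq => /eqP {1}->; rewrite mxE [in LHS]mxE mxE.
Qed.

Lemma toteff_connect (R : realType) n (E : rel 'I_n) (L : 'M[R]_n) u v :
  dag E -> supported E L -> ~~ connect E u v -> toteff L u v = 0.
Proof.
move=> dE sL; move: v; apply: (dag_ind dE) => v IH uv.
rewrite (toteff_rec _ _ dE sL); have [euv|_] := eqVneq u v.
  by rewrite euv connect0 in uv.
rewrite add0r big1 // => p _; have [pv|/sL ->] := boolP (E p v); last by rewrite mulr0.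
rewrite IH ?mul0r //; apply: contraNN uv => up; apply: connect_trans up _.
exact: connect1.
Qed.

(* With unit weights [toteff L u v] counts the directed paths from [u] to [v]. *)
Lemma toteff_gt0 (R : realType) n (E : rel 'I_n) u v :
  dag E -> connect E u v ->
  0 < toteff (\matrix_(x, y) (E x y)%:R : 'M[R]_n) u v.
Proof.
move=> dE; set L := \matrix_(x, y) _.
have sL : supported E L by move=> x y /negPf xy; rewrite mxE xy.
have L0 x y : 0 <= L x y by rewrite mxE ler0n.
have B0 y : 0 <= toteff L u y.
  move: y; apply: (dag_ind dE) => y IH; rewrite (toteff_rec _ _ dE sL).
  rewrite addr_ge0 ?ler0n ?sumr_ge0 // => p _.
  by have [/IH|/sL ->] := boolP (E p y); rewrite ?mulr0 // => ?; apply: mulr_ge0.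
case/connectP => p pp ->; elim/last_ind: p pp => [|p x IH].
  move=> _ /=; rewrite (toteff_rec _ _ dE sL) eqxx ltr_wpDr //.
  by apply: sumr_ge0 => q _; apply: mulr_ge0.
rewrite rcons_path last_rcons => /andP[/IH {}IH px].
rewrite (toteff_rec _ _ dE sL) ltr_wpDl ?ler0n //.
rewrite (bigD1 (last u p)) //= ltr_pwDl //.
  by rewrite mulr_gt0 // mxE px ltr01.
by apply: sumr_ge0 => q _; apply: mulr_ge0.
Qed.

Lemma covdagE (R : realType) n (L : 'M[R]_n) (w : 'rV[R]_n) :
  covdag L w = (toteff L)^T *m diag_mx w *m toteff L.
Proof. by rewrite /covdag /toteff -trmx_inv. Qed.

Lemma covmx_covdag (R : realType) n (E : rel 'I_n) (L : 'M[R]_n) (w : 'rV[R]_n) :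
  dag E -> supported E L -> (forall u, 0 < w 0 u) -> covmx (covdag L w).
Proof.
move=> dE sL w0; rewrite covdagE; split=> [|x x0].
  by rewrite !trmx_mul trmxK tr_diag_mx mulmxA.
set y := toteff L *m x.
have -> : x^T *m ((toteff L)^T *m diag_mx w *m toteff L) *m x = y^T *m diag_mx w *m y.
  by rewrite trmx_mul !mulmxA.
have y0 : y != 0.
  apply: contraNneq x0 => /(congr1 (mulmx (1%:M - L))).
  by rewrite mulmxA mulmxV ?(unit_1sub dE) // mul1mx mulmx0 => ->.
rewrite mxE; have [k yk] : exists k, y k 0 != 0.
  apply/existsP; apply: contraNT y0; rewrite negb_exists => /forallP yk.
  by apply/eqP/colP => k; rewrite [RHS]mxE; apply/eqP/negbNE/yk.
have e u : (y^T *m diag_mx w) 0 u * y u 0 = w 0 u * (y u 0) ^+ 2.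
  by rewrite mul_mx_diag !mxE; ring.
rewrite (eq_bigr _ (fun u _ => e u)) (bigD1 k) //= ltr_pwDl //.
  by rewrite mulr_gt0 // exprn_even_gt0.
by apply: sumr_ge0 => u _; rewrite mulr_ge0 ?sqr_ge0 // ltW.
Qed.

(** The structural equation of [v] paired with the variable [u]; the last term is the covariance of
    the noise at [v] with [u]. *)
Lemma covdag_rec (R : realType) n (E : rel 'I_n) (L : 'M[R]_n) (w : 'rV[R]_n) v u :
  dag E -> supported E L ->
  covdag L w v u = \sum_p L p v * covdag L w p u + w 0 v * toteff L v u.
Proof.
move=> dE sL; have L1u := unit_1sub dE sL.
have : (1%:M - L)^T *m covdag L w = diag_mx w *m toteff L.
  by rewrite /covdag !mulmxA mulmxV ?mul1mx // unitmx_tr.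
rewrite linearB /= trmx1 mulmxBl mul1mx => /eqP; rewrite subr_eq => /eqP {1}->.
rewrite mxE mul_diag_mx mxE addrC; congr (_ + _).
by rewrite mxE; apply: eq_bigr => p _; rewrite mxE.
Qed.

(** The residual of [a] has coordinate zero at [s], and the noise at a sink is uncorrelated with
    every other variable, so only the parents of [s] contribute. *)
Lemma ccov_sink (R : realType) n (E : rel 'I_n) (L : 'M[R]_n)
    (w : 'rV[R]_n) (C : {set 'I_n}) s a :
  dag E -> supported E L -> (forall u, 0 < w 0 u) -> sink E s -> s \notin C ->
  a != s -> ccov (covdag L w) C s a = \sum_p L p s * ccov (covdag L w) C p a.
Proof.
move=> dE sL w0 sk sC as_; set S := covdag L w.
have cS : covmx S := covmx_covdag dE sL w0.
have [r Rr Er] := res_exists C a cS; rewrite Er.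
under eq_bigr do rewrite Er.
have step u : S s u * r u 0 = \sum_p L p s * (S p u * r u 0).
  have [->|us] := eqVneq u s.
    by rewrite Rr.1 // eq_sym (negPf as_) mulr0 big1 // => p _; rewrite !mulr0.
  rewrite /S (covdag_rec _ _ _ dE sL) (@toteff_connect _ _ E) ?mulr0 ?addr0 //.
    by rewrite mulr_suml; apply: eq_bigr => p _; rewrite mulrA.
  by apply: contraNN us => /(sink_connect sk) ->.
rewrite mxE (eq_bigr _ (fun u _ => step u)).
by rewrite exchange_big /=; apply: eq_bigr => p _; rewrite mxE mulr_sumr.
Qed.

(** The Sherman-Morrison formula; the second hypothesis makes its denominator 1, so the update stays
    affine in [x]. *)
Lemma toteff_update (R : realType) n (L : 'M[R]_n) (x : 'cV[R]_n) (m : 'rV[R]_n) :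
  1%:M - L \in unitmx -> m *m toteff L *m x = 0 ->
  toteff (L + x *m m) = toteff L *m (1%:M + x *m (m *m toteff L)).
Proof.
move=> Lu mx0; set T := 1%:M + _.
have AX : (1%:M - (L + x *m m)) *m (toteff L *m T) = 1%:M.
  rewrite opprD addrA mulmxBl mulmxA mulmxV // mul1mx.
  rewrite /T mulmxDr mulmx1 mulmxDr.
  have -> : x *m m *m (toteff L *m (x *m (m *m toteff L))) =
            x *m (m *m toteff L *m x) *m (m *m toteff L) by rewrite !mulmxA.
  by rewrite mx0 mulmx0 mul0mx addr0 !mulmxA addrK.
have [Au _] := mulmx1_unit AX.
by rewrite -[RHS](mulKmx Au) AX mulmx1.
Qed.

Lemma covdag_update (R : realType) n (L : 'M[R]_n) (x : 'cV[R]_n)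
    (m w : 'rV[R]_n) :
  1%:M - L \in unitmx -> m *m toteff L *m x = 0 ->
  let T := 1%:M + x *m (m *m toteff L) in
  covdag (L + x *m m) w = T^T *m covdag L w *m T.
Proof. by move=> Lu mx0 T; rewrite !covdagE toteff_update // -/T trmx_mul !mulmxA. Qed.

Lemma covdag_update_out (R : realType) n (L : 'M[R]_n) (x : 'cV[R]_n)
    (m w : 'rV[R]_n) u v :
  1%:M - L \in unitmx -> m *m toteff L *m x = 0 ->
  (m *m toteff L) 0 u = 0 -> (m *m toteff L) 0 v = 0 ->
  covdag (L + x *m m) w u v = covdag L w u v.
Proof.
move=> Lu mx0 mu mv; rewrite covdag_update //; set T := _ + _; set S := covdag L w.
have Tc z : (m *m toteff L) 0 z = 0 -> col z T = delta_mx z 0.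
  move=> z0; apply/colP => k; rewrite !mxE big_ord1 z0 mulr0 addr0.
  by rewrite eqxx andbT.
have e (A : 'M[R]_n) p q : A p q = ((delta_mx 0 p : 'rV_n) *m A *m (delta_mx q 0 : 'cV_n)) 0 0.
  by rewrite -rowE -colE !mxE.
rewrite e.
have -> : delta_mx 0 u *m (T^T *m S *m T) *m delta_mx v 0 = (col u T)^T *m S *m col v T.
  by rewrite !colE trmx_mul trmx_delta !mulmxA.
by rewrite !Tc // trmx_delta -e.
Qed.

Definition restrict (R : realType) n (L : 'M[R]_n) (s : 'I_n) : 'M[R]_n :=
  \matrix_(u, v) if v == s then 0 else L u v.

Lemma restrict_supported (R : realType) n (E : rel 'I_n) (L : 'M[R]_n) s :
  sink E s -> supported E L -> supported (del E s) (restrict L s).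
Proof.
move=> sk sL u v; rewrite mxE /del; have [//|vs] := eqVneq v s.
have [->|us] := eqVneq u s; first by move=> _; apply/sL/sk.
by rewrite !andbT => /sL.
Qed.

Lemma covdag_restrict (R : realType) n (E : rel 'I_n) (L : 'M[R]_n) (w : 'rV[R]_n) s u v :
  dag E -> sink E s -> supported E L -> u != s -> v != s ->
  covdag (restrict L s) w u v = covdag L w u v.
Proof.
move=> dE sk sL us vs; pose L' := restrict L s.
have sL' : supported E L'.
  apply: supported_sub (restrict_supported sk sL); exact: del_sub.
(* Restoring the arrows into [s] is a rank-one update, and a sink has no total effect on the other
   vertices. *)
have EL : L = L' + col s L *m delta_mx 0 s.
  apply/matrixP => p q; rewrite !mxE big_ord1 !mxE eqxx /=.
  by case: eqVneq => qs; rewrite ?mulr1 ?mulr0 ?add0r ?addr0 ?qs.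
have row_s z : z != s -> (delta_mx 0 s *m toteff L' : 'rV_n) 0 z = 0.
  move=> zs; rewrite -rowE mxE (toteff_connect dE sL') //.
  by apply: contraNN zs => /(sink_connect sk) ->.
rewrite [in RHS]EL covdag_update_out ?row_s //; first exact: unit_1sub dE sL'.
apply/matrixP => p q; rewrite !ord1 !mxE big1 // => z _.
have [->|zs] := eqVneq z s; last by rewrite row_s ?mul0r.
by rewrite [X in _ * X]mxE sL ?mulr0 // sk.
Qed.

Lemma ccov_restrict (R : realType) n (E : rel 'I_n) (L : 'M[R]_n)
    (w : 'rV[R]_n) (C : {set 'I_n}) s a b :
  dag E -> sink E s -> supported E L -> s \notin C -> a != s -> b != s ->
  ccov (covdag (restrict L s) w) C a b = ccov (covdag L w) C a b.
Proof.
move=> dE sk sL sC as_ bs; apply: eq_ccov => u v uC vC.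
have ne x y : x \in y |: C -> y != s -> x != s.
  by rewrite !inE => /orP[/eqP -> //|xC] _; apply: contraNneq sC => <-.
by rewrite (covdag_restrict _ dE) ?(ne _ _ uC) ?(ne _ _ vC).
Qed.

(** * Rational dependence on the edge weights *)

(** The denominator vanishes nowhere on the line, so no value depends on the convention for division
    by zero. *)
Definition ratfun (R : realType) (f : R -> R) : Prop :=
  exists p d : {poly R}, forall t, d.[t] != 0 /\ f t = p.[t] / d.[t].

Lemma ratfun_poly (R : realType) (p : {poly R}) : ratfun (fun t => p.[t]).
Proof. by exists p, 1 => t; rewrite hornerE divr1 oner_neq0. Qed.

Lemma ratfun_cst (R : realType) (c : R) : ratfun (fun=> c).
Proof. by exists c%:P, 1 => t; rewrite !hornerE divr1 oner_neq0. Qed.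

Lemma eq_ratfun (R : realType) (f g : R -> R) : f =1 g -> ratfun f -> ratfun g.
Proof. by move=> fg [p [d H]]; exists p, d => t; rewrite -fg. Qed.

Lemma ratfunD (R : realType) (f g : R -> R) :
  ratfun f -> ratfun g -> ratfun (fun t => f t + g t).
Proof.
move=> [p [d Hf]] [q [e Hg]]; exists (p * e + q * d), (d * e) => t.
have [d0 ->] := Hf t; have [e0 ->] := Hg t.
by rewrite !hornerE mulf_neq0 //; split=> //; field; rewrite d0 e0.
Qed.

Lemma ratfunM (R : realType) (f g : R -> R) :
  ratfun f -> ratfun g -> ratfun (fun t => f t * g t).
Proof.
move=> [p [d Hf]] [q [e Hg]]; exists (p * q), (d * e) => t.
have [d0 ->] := Hf t; have [e0 ->] := Hg t.
by rewrite !hornerM mulf_neq0 //; split=> //; rewrite invfM mulrACA.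
Qed.

Lemma ratfunV (R : realType) (f : R -> R) :
  (forall t, f t != 0) -> ratfun f -> ratfun (fun t => (f t)^-1).
Proof.
move=> f0 [p [d Hf]]; exists d, p => t; have [d0 e] := Hf t.
by move: (f0 t); rewrite e mulf_eq0 negb_or => /andP[p0 _]; rewrite invf_div.
Qed.

Lemma ratfun_sum (R : realType) (I : Type) (r : seq I) (F : I -> R -> R) :
  (forall i, ratfun (F i)) -> ratfun (fun t => \sum_(i <- r) F i t).
Proof.
move=> HF; elim: r => [|i r IH].
  by apply: eq_ratfun (ratfun_cst 0) => t; rewrite big_nil.
by apply: eq_ratfun (ratfunD (HF i) IH) => t; rewrite big_cons.
Qed.

Lemma ratfun_prod (R : realType) (I : Type) (r : seq I) (F : I -> R -> R) :
  (forall i, ratfun (F i)) -> ratfun (fun t => \prod_(i <- r) F i t).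
Proof.
move=> HF; elim: r => [|i r IH].
  by apply: eq_ratfun (ratfun_cst 1) => t; rewrite big_nil.
by apply: eq_ratfun (ratfunM (HF i) IH) => t; rewrite big_cons.
Qed.

Definition ratmx (R : realType) m n (A : R -> 'M[R]_(m, n)) : Prop :=
  forall i j, ratfun (fun t => A t i j).

Lemma ratmx_cst (R : realType) m n (A : 'M[R]_(m, n)) : ratmx (fun=> A).
Proof. by move=> i j; apply: ratfun_cst. Qed.

Lemma ratmx_tr (R : realType) m n (A : R -> 'M[R]_(m, n)) :
  ratmx A -> ratmx (fun t => (A t)^T).
Proof. by move=> HA i j; apply: eq_ratfun (HA j i) => t; rewrite mxE. Qed.

Lemma ratmx_mul (R : realType) m n p (A : R -> 'M[R]_(m, n)) (B : R -> 'M[R]_(n, p)) :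
  ratmx A -> ratmx B -> ratmx (fun t => A t *m B t).
Proof.
move=> HA HB i j; apply: (@eq_ratfun _ (fun t => \sum_k A t i k * B t k j)).
  by move=> t; rewrite mxE.
by apply: ratfun_sum => k; apply: ratfunM.
Qed.

Lemma ratfun_det (R : realType) n (A : R -> 'M[R]_n) :
  ratmx A -> ratfun (fun t => \det (A t)).
Proof.
move=> HA; apply: ratfun_sum => s; apply: ratfunM; first exact: ratfun_cst.
by apply: ratfun_prod => i.
Qed.

Lemma ratmx_inv (R : realType) n (A : R -> 'M[R]_n) :
  (forall t, A t \in unitmx) -> ratmx A -> ratmx (fun t => invmx (A t)).
Proof.
move=> Au HA i j.
apply: (@eq_ratfun _ (fun t => (\det (A t))^-1 * cofactor (A t) j i)).
  by move=> t; rewrite /invmx Au !mxE.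
apply: ratfunM.
  by apply: ratfunV (ratfun_det HA) => t; move: (Au t); rewrite unitmxE unitfE.
apply: ratfunM; first exact: ratfun_cst.
by apply: ratfun_det => k l; apply: eq_ratfun (HA _ _) => t; rewrite !mxE.
Qed.

Lemma ratfun_ccov (R : realType) n (S : R -> 'M[R]_n) (C : {set 'I_n}) a b :
  (forall t, covmx (S t)) -> ratmx S -> ratfun (fun t => ccov (S t) C a b).
Proof.
move=> cS rS; pose P := selmx R C.
apply: (@eq_ratfun _ (fun t => S t a b +
   (-1) * (S t *m P^T *m invmx (P *m S t *m P^T) *m P *m S t) a b)).
  by move=> t; rewrite ccovE [RHS]mxE mulN1r; congr (_ + _); rewrite [RHS]mxE.
apply: ratfunD; first exact: rS.
apply: ratfunM; first exact: ratfun_cst.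
do !apply: ratmx_mul => //; try exact: ratmx_cst.
apply: ratmx_inv => [t|]; first exact: covmx_sub_unit.
by do !apply: ratmx_mul => //; exact: ratmx_cst.
Qed.

(** Both numerators are nonzero polynomials, and so is their product, which has finitely many
    roots. *)
Lemma ratfun_generic (R : realType) (f g : R -> R) x y :
  ratfun f -> ratfun g -> f x != 0 -> g y != 0 -> exists t, f t != 0 /\ g t != 0.
Proof.
move=> [p [d Hf]] [q [e Hg]].
have nz h (r c : {poly R}) z : c.[z] != 0 /\ h z = r.[z] / c.[z] -> h z != 0 -> r != 0.
  by case=> _ -> ; apply: contraNneq => ->; rewrite horner0 mul0r.
move=> /(nz _ _ _ _ (Hf x)) p0 /(nz _ _ _ _ (Hg y)) q0.
have pq0 : p * q != 0 by rewrite mulf_neq0.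
have [t tr] : exists t, ~~ root (p * q) t.
  apply: contrapT => H; have H' t : root (p * q) t.
    by apply: contrapT => /negP Ht; apply: H; exists t.
  (* As many distinct natural numbers as the size of the polynomial: too many to be roots. *)
  pose rs := [seq (k%:R : R) | k <- iota 0 (size (p * q))].
  have : (size rs < size (p * q)%R)%N.
    apply: max_poly_roots => //; first by apply/allP => z _.
    rewrite map_inj_uniq ?iota_uniq //; exact: mulrIn (oner_neq0 R).
  by rewrite size_map size_iota ltnn.
exists t; move: tr; rewrite rootM negb_or /root => /andP[pt qt].
have [d0 ->] := Hf t; have [e0 ->] := Hg t.
by split; rewrite mulf_neq0 ?invr_eq0.
Qed.

(** Joins the weights [L1] at 0 to [L2] at 1, so that conditions attained separately at the two ends
    can be attained at one point. *)
Definition line (R : realType) n (L1 L2 : 'M[R]_n) (t : R) : 'M[R]_n :=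
  L1 + t *: (L2 - L1).

Lemma line_supported (R : realType) n (E : rel 'I_n) (L1 L2 : 'M[R]_n) t :
  supported E L1 -> supported E L2 -> supported E (line L1 L2 t).
Proof. by move=> s1 s2 u v uv; rewrite !mxE s1 // s2 // subrr mulr0 addr0. Qed.

Lemma ratmx_toteff (R : realType) n (E : rel 'I_n) (L1 L2 : 'M[R]_n) :
  dag E -> supported E L1 -> supported E L2 -> ratmx (fun t => toteff (line L1 L2 t)).
Proof.
move=> dE s1 s2; apply: ratmx_inv => [t|u v].
  exact: unit_1sub dE (line_supported t s1 s2).
apply: eq_ratfun (ratfun_poly (((1%:M - L1) u v)%:P - (L2 u v - L1 u v) *: 'X)) => t.
by rewrite !hornerE !mxE; ring.
Qed.

Lemma ratfun_ccov_line (R : realType) n (E : rel 'I_n) (L1 L2 : 'M[R]_n) (w : 'rV[R]_n)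
    (C : {set 'I_n}) a b :
  dag E -> supported E L1 -> supported E L2 -> (forall u, 0 < w 0 u) ->
  ratfun (fun t => ccov (covdag (line L1 L2 t) w) C a b).
Proof.
move=> dE s1 s2 w0; apply: ratfun_ccov => [t|].
  exact: covmx_covdag dE (line_supported t s1 s2) w0.
have rB := ratmx_toteff dE s1 s2.
have rS : ratmx (fun t => (toteff (line L1 L2 t))^T *m diag_mx w *m toteff (line L1 L2 t)).
  by do !apply: ratmx_mul => //; [apply: ratmx_tr | apply: ratmx_cst].
by move=> i j; apply: eq_ratfun (rS i j) => t; rewrite covdagE.
Qed.

(** * Conditional covariances and active walks *)

(** Induction on the number of edges. Among all edges choose one whose head [s] has the most
    ancestors; a child of [s] would have more, so [s] is a sink, and [del E s] loses at least that
    edge. *)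
Lemma sink_ind n (P : rel 'I_n -> Prop) :
  (forall E, (forall u v, ~~ E u v) -> P E) ->
  (forall E s, dag E -> sink E s -> P (del E s) -> P E) ->
  forall E, dag E -> P E.
Proof.
move=> P0 PS E dE; have [m] := ubnP #|[set e : 'I_n * 'I_n | E e.1 e.2]|.
elim: m E dE => // m IH E dE Em.
have [/existsP[e0 Ee0]|nE] := boolP [exists e : 'I_n * 'I_n, E e.1 e.2]; last first.
  apply: P0 => u v; apply: contraNN nE => uv; by apply/existsP; exists (u, v).
case: (@arg_maxnP _ e0 (fun e => E e.1 e.2)
        (fun e => #|[set u | connect E u e.2]|) Ee0) => [[q s]] /= qs smax.
have sk : sink E s.
  move=> v; apply/negP => sv; have /= := smax (s, v) sv.
  rewrite leqNgt => /negP; apply; apply/proper_card/properP; split.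
    apply/subsetP => x; rewrite !inE => xs; apply: connect_trans xs _.
    exact: connect1.
  by exists v; rewrite !inE ?connect0 // dE.
apply: (PS E s) => //; apply: IH; first exact: dag_sub (@del_sub _ E s) dE.
rewrite -ltnS; apply: leq_trans Em; rewrite ltnS.
apply/proper_card/properP; split.
  by apply/subsetP => e; rewrite !inE => /del_sub.
by exists (q, s); rewrite !inE //= /del eqxx !andbF.
Qed.

Lemma covdag_no_edge (R : realType) n (E : rel 'I_n) (L : 'M[R]_n) (w : 'rV[R]_n) u v :
  (forall x y, ~~ E x y) -> supported E L -> u != v -> covdag L w u v = 0.
Proof.
move=> E0 sL uv.
have dE : dag E by move=> x y; rewrite (negPf (E0 x y)).
rewrite (covdag_rec _ _ _ dE sL) big1 ?add0r.
  rewrite (toteff_connect dE sL) ?mulr0 //.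
  by apply: contraNN uv => /(sink_connect (E0 u)) ->.
by move=> p _; rewrite sL ?mul0r.
Qed.

(** The global Markov property in terms of covariances. A sink in [C] is removed by a Schur
    complement, a sink at an endpoint is replaced by its parents, and any other sink is simply cut
    off. *)
Lemma ccov_sound (R : realType) n (E : rel 'I_n) (L : 'M[R]_n) (w : 'rV[R]_n)
    (C : {set 'I_n}) a b :
  dag E -> supported E L -> (forall u, 0 < w 0 u) -> a != b ->
  a \notin C -> b \notin C -> ~ oconn E C a b -> ccov (covdag L w) C b a = 0.
Proof.
move=> dE sL w0; move: E dE L sL C a b.
apply: sink_ind => [E E0|E s dE sk IH] L sL C a b ab aC bC nc.
  have dE : dag E by move=> x y; rewrite (negPf (E0 x y)).
  have cS : covmx (covdag L w) := covmx_covdag dE sL w0.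
  have Rr : is_res (covdag L w) C a (delta_mx a 0).
    split=> [v vC|c cC]; first by rewrite mxE eqxx andbT.
    rewrite -colE mxE (covdag_no_edge _ E0 sL) //.
    by apply: contraNneq aC => <-.
  rewrite (ccov_res _ cS Rr) -colE mxE (covdag_no_edge _ E0 sL) //.
  by rewrite eq_sym.
have sL' := restrict_supported sk sL.
have cS : covmx (covdag L w) := covmx_covdag dE sL w0.
have ne x (D : {set 'I_n}) : s \in D -> x \notin D -> x != s.
  by move=> sD; apply: contraNneq => ->.
(* A nonzero covariance with the sink needs a nonzero covariance with some parent, which by
   induction is connected to [x]. *)
have parent (D : {set 'I_n}) x : x \notin D -> s \notin D -> x != s ->
    ccov (covdag L w) D s x != 0 ->
    exists p, [/\ E p s, p \notin D & oconn (del E s) D x p].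
  move=> xD sD xs; rewrite (ccov_sink dE sL w0 sk sD xs).
  move=> sum0; apply: contrapT => np; case/negP: sum0; apply/eqP.
  apply: big1 => p _.
  have [ps|/sL ->] := boolP (E p s); last by rewrite mul0r.
  have [pD|pD] := boolP (p \in D); first by rewrite ccov_in ?mulr0.
  have ps' : p != s by apply: contraTneq ps => ->; rewrite dag_irr.
  have [px|px] := eqVneq x p.
    by case: np; exists p; rewrite px; split=> //; exists false; apply: oreach0.
  rewrite -(ccov_restrict _ dE sk sL sD ps' xs) IH ?mulr0 // => xp.
  by case: np; exists p.
have [sC|sC] := boolP (s \in C).
  set D := C :\ s.
  have sD : s \notin D by rewrite !inE eqxx.
  have nD x : x \notin C -> x \notin D by rewrite !inE negb_and => ->; rewrite orbT.
  have as_ := ne _ _ sC aC; have bs := ne _ _ sC bC.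
  have nc' := nc; rewrite (oconn_sink_in dE sk sC aC bC) in nc'.
  rewrite -(setD1K sC) -/D ccov_setU1 //.
  rewrite -(ccov_restrict _ dE sk sL sD bs as_) IH ?nD //; last by move=> H; apply: nc'; left.
  have fd x : x \notin C -> ccov (covdag L w) D s x != 0 -> feeds E C s x.
    move=> xC /(parent D x (nD _ xC) sD (ne _ _ sC xC)) [p [ps pD H]].
    exists p; split=> //; apply: contraNN pD; rewrite !inE => ->; rewrite andbT.
    by apply: contraTneq ps => ->; rewrite dag_irr.
  rewrite (ccovC cS (nD _ bC) sD).
  (* The correction term is a product; both factors nonzero would connect [a] and [b] through the
     collider [s]. *)
  have [->|/(fd _ bC) fb] := eqVneq (ccov (covdag L w) D s b) 0.
    by rewrite !mul0r subrr.
  have [->|/(fd _ aC) fa] := eqVneq (ccov (covdag L w) D s a) 0.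
    by rewrite mulr0 mul0r subrr.
  by case: nc'; right.
have [bs|bs] := eqVneq b s.
  rewrite bs in nc bC ab *; apply/eqP/contraT => /(parent C a aC sC ab) H.
  by case: nc; apply/oconn_sink_end.
have [as_|as_] := eqVneq a s.
  rewrite ccovC //; rewrite as_ in nc aC ab *.
  rewrite eq_sym in ab.
  apply/eqP/contraT => /(parent C b bC sC ab) H.
  by case: nc; apply: oconn_sym => //; apply/oconn_sink_end.
rewrite -(ccov_restrict _ dE sk sL sC bs as_) IH // => -[d H]; apply: nc.
by exists d; apply: oreach_mono H; apply: del_sub.
Qed.

Definition add_col (R : realType) n (L : 'M[R]_n) (s : 'I_n) (c : 'I_n -> R) : 'M[R]_n :=
  \matrix_(u, v) if v == s then c u else L u v.

Lemma add_col_supported (R : realType) n (E : rel 'I_n) (L : 'M[R]_n) s c :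
  supported (del E s) L -> (forall q, ~~ E q s -> c q = 0) ->
  supported E (add_col L s c).
Proof.
move=> sL c0 u v; rewrite mxE; case: eqVneq => [->|vs] uv; first exact: c0.
by apply: sL; apply: contraNN uv; apply: del_sub.
Qed.

Lemma restrict_add_col (R : realType) n (E : rel 'I_n) (L : 'M[R]_n) s c :
  supported (del E s) L -> restrict (add_col L s c) s = L.
Proof.
move=> sL; apply/matrixP => u v; rewrite !mxE; case: eqVneq => // ->.
by rewrite sL // /del eqxx !andbF.
Qed.

(** One of the two unit vectors works, or else each of them kills one of the forms and their sum
    works. *)
Lemma linear_forms_generic (R : realType) n (A D : 'I_n -> R) q1 q2 :
  A q1 != 0 -> D q2 != 0 ->
  exists c : 'I_n -> R, [/\ \sum_q c q * A q != 0, \sum_q c q * D q != 0 &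
    forall q, q != q1 -> q != q2 -> c q = 0].
Proof.
move=> A1 D2.
have sumd q (F : 'I_n -> R) : \sum_x (x == q)%:R * F x = F q.
  rewrite (bigD1 q) //= eqxx mul1r big1 ?addr0 // => x /negPf ->.
  by rewrite mul0r.
have [D1|D1] := eqVneq (D q1) 0; last first.
  by exists (fun q => (q == q1)%:R); rewrite !sumd; split=> // q /negPf ->.
have [A2|A2] := eqVneq (A q2) 0; last first.
  by exists (fun q => (q == q2)%:R); rewrite !sumd; split=> // q _ /negPf ->.
exists (fun q => (q == q1)%:R + (q == q2)%:R).
have sumd2 (F : 'I_n -> R) :
    \sum_x ((x == q1)%:R + (x == q2)%:R) * F x = F q1 + F q2.
  by rewrite -[F q1]sumd -[F q2]sumd -big_split /=; apply: eq_bigr => x _; rewrite mulrDl.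
rewrite !sumd2 D1 A2 addr0 add0r; split=> // q /negPf -> /negPf ->.
by rewrite addr0.
Qed.

(** Weights are built up sink by sink, all noise variances being 1. The sink lemmas for walks tell
    which covariances of the smaller graph must be made nonzero. *)
Lemma ccov_complete (R : realType) n (E : rel 'I_n) (C : {set 'I_n}) a b :
  dag E -> a \notin C -> b \notin C -> oconn E C a b ->
  exists2 L : 'M[R]_n, supported E L & ccov (covdag L (const_mx 1)) C b a != 0.
Proof.
move=> dE; pose w : 'rV[R]_n := const_mx 1.
have w0 u : 0 < w 0 u by rewrite mxE ltr01.
have self E0 (D : {set 'I_n}) x : dag E0 -> x \notin D ->
    exists2 L : 'M[R]_n, supported E0 L & ccov (covdag L w) D x x != 0.
  move=> dE0 xD; have s0 : supported E0 (0 : 'M[R]_n) by move=> u v _; rewrite mxE.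
  by exists 0 => //; rewrite gt_eqF // ccov_gt0 //; apply: covmx_covdag dE0 s0 w0.
rewrite -/w; move: E dE C a b.
apply: sink_ind => [E E0|E s dE sk IH] C a b aC bC H.
  have dE : dag E by move=> x y; rewrite (negPf (E0 x y)).
  have <- : a = b.
    case: H => d H; case: H => // [d' v x _ _|v x _ _|v x _ _]; by rewrite (negPf (E0 _ _)).
  exact: self.
have [->|ab] := eqVneq a b; first exact: self.
have dE' : dag (del E s) := dag_sub (@del_sub _ E s) dE.
have to_sink x : x \notin C -> s \notin C -> x != s -> oconn E C x s ->
    exists2 L : 'M[R]_n, supported E L & ccov (covdag L w) C s x != 0.
  move=> xC sC xs /(oconn_sink_end dE sk sC xs) [p [ps pC /IH]] [] // L sL Lp.
  have ps' : p != s by apply: contraTneq ps => ->; rewrite dag_irr.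
  (* Only the arrow from [p] gets weight, so the sink inherits the covariance of [p]. *)
  pose L1 := add_col L s (fun q => (q == p)%:R).
  have sL1 : supported E L1.
    by apply: add_col_supported => // q; case: eqVneq => // ->; rewrite ps.
  exists L1 => //; rewrite (ccov_sink dE sL1 w0 sk sC xs) (bigD1 p) //=.
  rewrite big1 => [|q /negPf qp]; last by rewrite mxE eqxx qp mul0r.
  rewrite mxE !eqxx mul1r addr0.
  by rewrite -(ccov_restrict w dE sk sL1 sC ps' xs) (restrict_add_col _ sL).
have [sC|sC] := boolP (s \in C); last first.
  have [bs|bs] := eqVneq b s; first by rewrite bs in H bC ab *; apply: to_sink.
  have [as_|as_] := eqVneq a s.
    have H' : oconn E C b s by rewrite -as_; apply: oconn_sym.
    rewrite as_ in aC; have [L sL Lb] := to_sink b bC aC bs H'.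
    by exists L => //; rewrite as_ ccovC //; apply: covmx_covdag dE sL w0.
  have nos u : u != s -> ~~ connect E s u.
    by apply: contraNN => /(sink_connect sk) ->.
  have sC' : ~~ anc E C s.
    by apply/negP => /ancP[c Cc /(sink_connect sk) cs]; rewrite -cs Cc in sC.
  have [L sL Lab] := IH C a b aC bC (oconn_del (nos _ as_) (nos _ bs) sC' H).
  by exists L => //; apply: supported_sub sL; apply: del_sub.
set D := C :\ s.
have sD : s \notin D by rewrite !inE eqxx.
have nD x : x \notin C -> x \notin D by rewrite !inE negb_and => ->; rewrite orbT.
have ne x : x \notin C -> x != s by apply: contraNneq => ->.
have as_ := ne _ aC; have bs := ne _ bC.
have schur L c (L1 := add_col L s c) : supported (del E s) L ->
    (forall q, ~~ E q s -> c q = 0) ->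
    let S := covdag L w in
    ccov (covdag L1 w) C b a = ccov S D b a -
      (\sum_q c q * ccov S D q b) * (\sum_q c q * ccov S D q a) / ccov (covdag L1 w) D s s.
  move=> sL c0 S; have sL1 : supported E L1 by apply: add_col_supported.
  have cS1 : covmx (covdag L1 w) := covmx_covdag dE sL1 w0.
  have rL x y : x != s -> y != s -> ccov (covdag L1 w) D x y = ccov S D x y.
    move=> xs ys; rewrite -(ccov_restrict w dE sk sL1 sD xs ys).
    by rewrite (restrict_add_col _ sL).
  rewrite -{1}(setD1K sC) -/D ccov_setU1 // rL // (ccovC cS1 (nD _ bC) sD).
  rewrite (ccov_sink dE sL1 w0 sk sD as_) (ccov_sink dE sL1 w0 sk sD bs).
  congr (_ - _ * _ / _); apply: eq_bigr => q _; rewrite mxE eqxx;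
    (have [->|qs] := eqVneq q s; [by rewrite c0 ?mul0r ?sk | by rewrite rL]).
(* If the covariance given [D] can be nonzero without [s], zero weights into [s] preserve it.
   Otherwise it vanishes for all weights, and only the product term of [schur] is left to be made
   nonzero. *)
have [[L sL Lab]|none] := pselect (exists2 L : 'M[R]_n, supported (del E s) L &
    ccov (covdag L w) D b a != 0).
  exists (add_col L s (fun=> 0)); first by apply: add_col_supported.
  rewrite schur // big1 ?mul0r ?subr0 // => q _.
  by rewrite mul0r.
have [|[[q1 [q1s q1C H1]] [q2 [q2s q2C H2]]]] := (oconn_sink_in dE sk sC aC bC).1 H.
  by move/(IH D a b (nD _ aC) (nD _ bC)) => [L sL Lab]; case: none; exists L.
have [L1 s1 N1] := IH _ _ _ (nD _ aC) (nD _ q1C) H1.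
have [L2 s2 N2] := IH _ _ _ (nD _ bC) (nD _ q2C) H2.
have [||t [tA tB]] := ratfun_generic (x := 0) (y := 1)
    (ratfun_ccov_line D q1 a dE' s1 s2 w0) (ratfun_ccov_line D q2 b dE' s1 s2 w0).
- by rewrite /line scale0r addr0.
- by rewrite /line scale1r addrC subrK.
have sL := line_supported t s1 s2.
set L := line L1 L2 t in sL tA tB.
have [c [cA cB c0]] := linear_forms_generic
   (A := fun q => ccov (covdag L w) D q a) (D := fun q => ccov (covdag L w) D q b) tA tB.
have c0' q : ~~ E q s -> c q = 0.
  by move=> qs; apply: c0; apply: contraNneq qs => ->.
exists (add_col L s c); first exact: add_col_supported.
rewrite schur //.
have -> : ccov (covdag L w) D b a = 0.
  by apply/eqP/contraT => Lab; case: none; exists L.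
rewrite sub0r oppr_eq0 !mulf_neq0 // invr_eq0 gt_eqF // ccov_gt0 //.
by apply: covmx_covdag dE _ w0; apply: add_col_supported.
Qed.

(** * Tuning one edge weight *)

(** With [beta] the total effects of [m], congruence by this matrix adds [x] to the weight of the
    edge from [j] to [m]. *)
Definition shear (R : realType) n (j : 'I_n) (beta : 'rV[R]_n) (x : R) : 'M[R]_n :=
  1%:M + (x *: delta_mx j 0) *m beta.

Lemma shear_mul (R : realType) n (j : 'I_n) (beta : 'rV[R]_n) x (r : 'cV[R]_n) :
  shear j beta x *m r = r + (x * (beta *m r) 0 0) *: delta_mx j 0.
Proof.
rewrite /shear mulmxDl mul1mx -mulmxA {1}[beta *m r]mx11_scalar -scalemxAl.
by rewrite mul_mx_scalar scalerA.
Qed.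

(** The corrected vector is the preimage of [r] under the shear, as [beta] vanishes at [j]. The
    transposed shear only adds multiples of the entry at [j] of [S *m r], which is zero because [j]
    lies in [C]. *)
Lemma shear_res (R : realType) n (S : 'M[R]_n) (C : {set 'I_n}) j a
    (beta : 'rV[R]_n) x r :
  beta 0 j = 0 -> j \in C -> is_res S C a r ->
  is_res ((shear j beta x)^T *m S *m shear j beta x) C a
    (r - (x * (beta *m r) 0 0) *: delta_mx j 0) /\
  (forall v, (((shear j beta x)^T *m S *m shear j beta x) *m
    (r - (x * (beta *m r) 0 0) *: delta_mx j 0)) v 0 = (S *m r) v 0).
Proof.
move=> bj jC Rr; set r' := r - _; set T := shear _ _ _.
have Tr' : T *m r' = r.
  rewrite /T shear_mul.
  have -> : (beta *m r') 0 0 = (beta *m r) 0 0.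
    by rewrite /r' mulmxBr -scalemxAr -colE !mxE bj mulr0 subr0.
  by rewrite /r' subrK.
have E v : ((T^T *m S *m T) *m r') v 0 = (S *m r) v 0.
  rewrite -mulmxA Tr' -mulmxA.
  have -> : T^T *m (S *m r) = S *m r + (x *: beta^T) *m (delta_mx 0 j *m (S *m r)).
    rewrite /T /shear linearD /= trmx1 mulmxDl mul1mx; congr (_ + _).
    by rewrite trmx_mul linearZ /= trmx_delta -scalemxAr -!scalemxAl !mulmxA.
  rewrite mxE [X in _ + X]mxE big_ord1 -rowE [row _ _ _ _]mxE.
  by rewrite (Rr.2 j jC) mulr0 addr0.
split=> //; split=> [v vC|c cC]; last by rewrite E Rr.2.
rewrite !mxE [v == j](_ : _ = false) ?mulr0 ?subr0 ?Rr.1 //.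
by apply: contraNF vC => /eqP ->.
Qed.

Lemma ccov_shear (R : realType) n (S : 'M[R]_n) (C : {set 'I_n}) j a b
    (beta : 'rV[R]_n) x :
  covmx S -> covmx ((shear j beta x)^T *m S *m shear j beta x) ->
  beta 0 j = 0 -> j \in C ->
  ccov ((shear j beta x)^T *m S *m shear j beta x) C b a = ccov S C b a.
Proof.
move=> cS cS' bj jC; have [r Rr ->] := res_exists C a cS.
by have [Rr' E] := shear_res x bj jC Rr; rewrite (ccov_res _ cS' Rr') E.
Qed.

Lemma qformZ (R : realType) n (S : 'M[R]_n) (a : R) (x : 'cV[R]_n) :
  qform S (a *: x) (a *: x) = a ^+ 2 * qform S x x.
Proof.
rewrite /qform -scalemxAr mxE expr2 -mulrA; congr (_ * _).
by rewrite linearZ /= -!scalemxAl mxE.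
Qed.

(** The gap in the conclusion is [v] times the gap in the hypothesis. Here [d] stands for the
    variance of [l] given [j] and [K]. *)
Lemma tuning_arith (R : realType) (c v yi yl d : R) :
  0 < v -> v * yi ^+ 2 * d < c ^+ 2 + 2 * c * yi * yl * v ->
  (yi * v) ^+ 2 * (d + yl ^+ 2 * v) < (c + yi * yl * v) ^+ 2 * v.
Proof.
move=> v0 H; rewrite -subr_gt0.
have -> : (c + yi * yl * v) ^+ 2 * v - (yi * v) ^+ 2 * (d + yl ^+ 2 * v) =
  v * (c ^+ 2 + 2 * c * yi * yl * v - v * yi ^+ 2 * d) by ring.
by rewrite mulr_gt0 // subr_gt0.
Qed.

Lemma tuning (R : realType) n (S : 'M[R]_n) (K : {set 'I_n}) i j l (beta : 'rV[R]_n) t :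
  covmx S -> (forall x, covmx ((shear j beta x)^T *m S *m shear j beta x)) ->
  i != j -> l != j -> i \notin K -> j \notin K -> l \notin K ->
  beta 0 j = 0 -> ccov S (j |: K) l i != 0 ->
  t \in i |: (l |: K) -> beta 0 t != 0 ->
  exists x, let N := ccov ((shear j beta x)^T *m S *m shear j beta x) K in
    N j i ^+ 2 * N l l < N l i ^+ 2 * N j j.
Proof.
move=> cS cSx ij lj iK jK lK bj c0 tiK bt.
have jJ : j \in j |: K by rewrite !inE eqxx.
have [ri Ri _] := res_exists (j |: K) i cS.
have [rl Rl _] := res_exists (j |: K) l cS.
pose bi := (beta *m ri) 0 0; pose bl := (beta *m rl) 0 0.
pose N x := ccov ((shear j beta x)^T *m S *m shear j beta x) K.
pose yi x := x * bi - ri j 0; pose yl x := x * bl - rl j 0.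
set c := ccov S _ l i in c0; pose d := ccov S (j |: K) l l.
have coordj (r : 'cV[R]_n) y : (r - y *: delta_mx j 0) j 0 = r j 0 - y.
  by rewrite !mxE !eqxx mulr1.
have Nji x : N x j i = yi x * N x j j.
  rewrite /N (ccov_res_coord (cSx x) jK iK ij (shear_res x bj jJ Ri).1).
  by rewrite coordj opprB.
have Njl x : N x j l = yl x * N x j j.
  rewrite /N (ccov_res_coord (cSx x) jK lK lj (shear_res x bj jJ Rl).1).
  by rewrite coordj opprB.
have v0 x : 0 < N x j j by apply: ccov_gt0.
have Nlj x : N x l j = N x j l by rewrite /N ccovC.
have schur x a : a != j -> N x l a = ccov S (j |: K) l a + yl x * N x j a.
  move=> aj; rewrite -(ccov_shear a l cS (cSx x) bj jJ) ccov_setU1 //.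
  rewrite -!/(N x _ _) Nlj Njl mulrAC mulfK ?gt_eqF // ?subrK //.
suff [x Hx] : exists x, N x j j * yi x ^+ 2 * d <
                        c ^+ 2 + 2 * c * yi x * yl x * N x j j.
  exists x; rewrite -/(N x) /= schur // [N x l i]schur // Nji Njl -/c -/d.
  have := tuning_arith (v0 x) Hx.
  by rewrite [yl x * (yl x * _)]mulrA -expr2 [yl x * (yi x * _)]mulrA [yl x * yi x]mulrC.
have c2 : 0 < c ^+ 2 by rewrite exprn_even_gt0.
have [bi0|bi0] := eqVneq bi 0; last first.
  (* First case: [yi] is made zero, and only the square of [c] remains. *)
  exists (ri j 0 / bi); have -> : yi (ri j 0 / bi) = 0 by rewrite /yi divfK ?subrr.
  by rewrite expr0n /= mulr0 mul0r mulr0 !mul0r addr0.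
have yiE x : yi x = - ri j 0 by rewrite /yi bi0 mulr0 sub0r.
have [bl0|bl0] := eqVneq bl 0; last first.
  (* Second case: [yi] is constant, and this value of [yl] makes the mixed term equal to the left
     side. *)
  pose y := - ri j 0 * d / (2 * c).
  exists ((y + rl j 0) / bl); rewrite yiE.
  have -> : yl ((y + rl j 0) / bl) = y by rewrite /yl divfK // addrK.
  set x := _ / bl; have -> : 2 * c * - ri j 0 * y * N x j j = N x j j * (- ri j 0) ^+ 2 * d.
    by rewrite /y; field.
  by rewrite ltrDr.
have ylE x : yl x = - rl j 0 by rewrite /yl bl0 mulr0 sub0r.
(* Third case: both coefficients are constant. If [beta] vanished on [K], its product with the
   residual of [i] or [l] would be its entry there, so [beta] would vanish at [t] too. *)
have [k kK bk] : exists2 k, k \in K & beta 0 k != 0.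
  apply: contrapT => nk.
  have bK k : k \in K -> beta 0 k = 0.
    by move=> kK; apply/eqP/contraT => bk; case: nk; exists k.
  have bres a r : a != j -> is_res S (j |: K) a r -> (beta *m r) 0 0 = 0 -> beta 0 a = 0.
    move=> aj Rr; have [/bK //|aK] := boolP (a \in K).
    rewrite mxE (bigD1 a) //= Rr.1 ?eqxx ?mulr1 ?inE ?negb_or ?aj // big1 ?addr0 //.
    move=> v va; have [->|vj] := eqVneq v j; first by rewrite bj mul0r.
    have [/bK ->|vK] := boolP (v \in K); first by rewrite mul0r.
    by rewrite Rr.1 ?(negPf va) ?mulr0 // !inE negb_or vj.
  move: tiK bt; rewrite !inE => /or3P[/eqP ->|/eqP ->|/bK ->].
  - by rewrite (bres _ _ ij Ri bi0) eqxx.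
  - by rewrite (bres _ _ lj Rl bl0) eqxx.
  - by rewrite eqxx.
pose s := qform S (delta_mx k 0) (delta_mx k 0) / beta 0 k ^+ 2.
have vle x : x != 0 -> N x j j <= s / x ^+ 2.
  (* This test vector is chosen so that the shear cancels its [j] coordinate, leaving a multiple of
     the unit vector at [k] of order [1 / x]. *)
  move=> x0; pose u : 'cV[R]_n := delta_mx j 0 - (x * beta 0 k)^-1 *: delta_mx k 0.
  have u1 v : v \notin K -> u v 0 = (v == j)%:R.
    move=> vK; rewrite !mxE !eqxx !andbT [v == k](_ : _ = false) ?mulr0 ?subr0 //.
    by apply: contraNF vK => /eqP ->.
  apply: le_trans (ccov_le_qform (cSx x) jK u1) _.
  have Tu : shear j beta x *m u = - (x * beta 0 k)^-1 *: delta_mx k 0.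
    rewrite shear_mul.
    have -> : (beta *m u) 0 0 = - x^-1.
      rewrite /u mulmxBr -scalemxAr -!colE !mxE bj sub0r.
      by congr (- _); field; rewrite x0.
    by rewrite mulrN divff // scaleN1r /u addrAC subrr sub0r scaleNr.
  rewrite {1}/qform.
  have -> : u^T *m ((shear j beta x)^T *m S *m shear j beta x) *m u =
     (shear j beta x *m u)^T *m S *m (shear j beta x *m u).
    by rewrite trmx_mul !mulmxA.
  rewrite Tu -/(qform _ _ _) qformZ /s.
  rewrite le_eqVlt; apply/orP; left; apply/eqP.
  by field; rewrite x0.
have s0 : 0 <= s by rewrite divr_ge0 ?sqr_ge0 ?qform_ge0.
pose M := `|(ri j 0) ^+ 2 * d - 2 * c * ri j 0 * rl j 0|.
(* Then [s * M] equals [c ^+ 2 * (x - 1)], which is below [c ^+ 2 * x ^+ 2]. *)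
pose x := 1 + s * M / c ^+ 2.
have M0 : 0 <= M by apply: normr_ge0.
have sM : 0 <= s * M / c ^+ 2 by apply: divr_ge0; [apply: mulr_ge0 | apply: ltW].
have x1 : 1 <= x by rewrite lerDl.
exists x; rewrite yiE ylE.
suff : N x j j * M < c ^+ 2.
  have : N x j j * ((ri j 0) ^+ 2 * d - 2 * c * ri j 0 * rl j 0) <= N x j j * M.
    by rewrite ler_pM2l // ler_norm.
  by nra.
have x0 : 0 < x by apply: lt_le_trans x1.
apply: (@le_lt_trans _ _ (s / x ^+ 2 * M)).
  by rewrite ler_wpM2r // vle // gt_eqF.
rewrite mulrAC ltr_pdivrMr ?exprn_gt0 //.
have : s * M = c ^+ 2 * (x - 1) by rewrite /x addrC addKr; field.
move=> ->; rewrite ltr_pM2l //; nra.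
Qed.

(** * Comparison of partial correlations *)

Lemma pcor_sqr (R : realType) n (S : 'M[R]_n) (C : {set 'I_n}) a b :
  covmx S -> a \notin C -> b \notin C ->
  pcor S C a b ^+ 2 = ccov S C b a ^+ 2 / (ccov S C a a * ccov S C b b).
Proof.
move=> cS aC bC; rewrite /pcor exprMn exprVn sqr_sqrtr; last first.
  by rewrite ltW // mulr_gt0 // ccov_gt0.
by rewrite ccovC.
Qed.

Lemma pcor_le (R : realType) n (S : 'M[R]_n) (C : {set 'I_n}) a b c :
  covmx S -> a \notin C -> b \notin C -> c \notin C ->
  (`|pcor S C a c| <= `|pcor S C a b|) =
  (ccov S C c a ^+ 2 * ccov S C b b <= ccov S C b a ^+ 2 * ccov S C c c).
Proof.
move=> cS aC bC cC.
have a0 := ccov_gt0 cS aC; have b0 := ccov_gt0 cS bC; have c0 := ccov_gt0 cS cC.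
rewrite -ler_sqr ?nnegrE ?normr_ge0 // !real_normK ?num_real // !pcor_sqr //.
rewrite ler_pdivrMr ?mulr_gt0 // mulrAC ler_pdivlMr ?mulr_gt0 //.
rewrite [X in X <= _](_ : _ = (ccov S C c a ^+ 2 * ccov S C b b) * ccov S C a a); last by ring.
rewrite [X in _ <= X](_ : _ = (ccov S C b a ^+ 2 * ccov S C c c) * ccov S C a a).
  by rewrite ler_pM2r.
by ring.
Qed.

(** Strict, because the difference of the two sides is a positive multiple of the variance of [a]
    given [b] and [C]. *)
Lemma ccov_cauchy (R : realType) n (S : 'M[R]_n) (C : {set 'I_n}) a b :
  covmx S -> a \notin C -> b \notin C -> a != b ->
  ccov S C b a ^+ 2 < ccov S C a a * ccov S C b b.
Proof.
move=> cS aC bC ab; have b0 := ccov_gt0 cS bC.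
have : 0 < ccov S (b |: C) a a by apply: ccov_gt0; rewrite // !inE negb_or ab.
rewrite ccov_setU1 // (ccovC cS aC bC) subr_gt0 ltr_pdivrMr //.
Qed.

Lemma pcor_le1 (R : realType) n (S : 'M[R]_n) (C : {set 'I_n}) a b :
  covmx S -> a \notin C -> b \notin C -> a != b -> `|pcor S C a b| <= 1.
Proof.
move=> cS aC bC ab; rewrite -ler_sqr ?nnegrE ?normr_ge0 // expr1n.
rewrite real_normK ?num_real // pcor_sqr // ler_pdivrMr ?mulr_gt0 ?ccov_gt0 //.
by rewrite mul1r ltW // ccov_cauchy.
Qed.

(** By soundness, the covariance of [i] and [l] given [K] factors through [j]; Cauchy-Schwarz for
    [j] and [l] finishes. *)
Lemma inclusion_of_oconn (R : realType) n (E : rel 'I_n) (S : 'M[R]_n) (i j l : 'I_n)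
    (K : {set 'I_n}) :
  dag E -> i != j -> i != l -> j != l -> i \notin K -> j \notin K -> l \notin K ->
  ~ oconn E (j |: K) i l -> gaussian_dag E S -> covmx S ->
  `|pcor S K i l| <= `|pcor S K i j|.
Proof.
move=> dE ij il jl iK jK lK nc [L [w [sL [w0 ES]]]] cS; rewrite pcor_le //.
have iJ : i \notin j |: K by rewrite !inE negb_or ij.
have lJ : l \notin j |: K by rewrite !inE negb_or eq_sym jl.
have := ccov_sound dE sL w0 il iJ lJ nc; rewrite /covdag -ES ccov_setU1 //.
move=> /eqP; rewrite subr_eq0 => /eqP ->.
have j0 := ccov_gt0 cS jK.
have /ltW := ccov_cauchy cS jK lK jl.
set x := ccov S K l j; set y := ccov S K j i; set v := ccov S K j j => H.
have -> : (x * y / v) ^+ 2 * v = y ^+ 2 * (x ^+ 2 / v).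
  by field; rewrite gt_eqF.
by rewrite ler_wpM2l ?sqr_ge0 // ler_pdivrMr // mulrC.
Qed.

Lemma separating_covariance (R : realType) n (E : rel 'I_n) (i j l : 'I_n)
    (K : {set 'I_n}) :
  dag E -> i != j -> i != l -> j != l -> i \notin K -> j \notin K -> l \notin K ->
  oconn E K i l -> oconn E (j |: K) i l ->
  exists S : 'M[R]_n, [/\ gaussian_dag E S, covmx S &
    ccov S K j i ^+ 2 * ccov S K l l < ccov S K l i ^+ 2 * ccov S K j j].
Proof.
move=> dE ij il jl iK jK lK cK cJ; pose w : 'rV[R]_n := const_mx 1.
have w0 u : 0 < w 0 u by rewrite mxE ltr01.
have iJ : i \notin j |: K by rewrite !inE negb_or ij.
have lJ : l \notin j |: K by rewrite !inE negb_or eq_sym jl.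
have gd L : supported E L -> gaussian_dag E (covdag L w) by move=> sL; exists L, w.
have cd L : supported E L -> covmx (covdag L w).
  by move=> sL; apply: covmx_covdag dE sL w0.
have [/existsP[t /andP[tiK jt]]|nt] :=
    boolP [exists t, (t \in i |: (l |: K)) && connect E j t]; last first.
  have nj t : t \in i |: (l |: K) -> ~~ connect E j t.
    by move=> tiK; apply: contraNN nt => jt; apply/existsP; exists t; rewrite tiK.
  have [|||L sL Lil] := ccov_complete R (dag_sub (@del_sub _ E j) dE) iK lK
       (oconn_del (j := j) _ _ _ cK).
  - by apply: nj; rewrite !inE eqxx.
  - by apply: nj; rewrite !inE eqxx orbT.
  - by apply/negP => /ancP[t tK]; apply/negP/nj; rewrite !inE tK !orbT.
  have sL' : supported E L by apply: supported_sub sL; apply: del_sub.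
  exists (covdag L w); split; [exact: gd | exact: cd |].
  (* In the graph without the edges at [j], the vertex [j] is a sink without parents, so its
     covariance with [i] vanishes. *)
  rewrite (ccov_sink (dag_sub (@del_sub _ E j) dE) sL w0) //; last first.
    by move=> v; rewrite /del eqxx andbF.
  rewrite big1 => [|p _]; last by rewrite sL ?mul0r // /del eqxx !andbF.
  by rewrite expr0n mul0r mulr_gt0 // ?exprn_even_gt0 // ccov_gt0 //; apply: cd.
have tj : t != j.
  apply: contraTneq tiK => ->; rewrite !inE !negb_or jK andbT (eq_sym j i) ij.
  by rewrite jl.
have [m jm mt] : exists2 m, E j m & connect E m t.
  case/connectP: jt => [[|m p] /=]; first by move=> _ et; rewrite et eqxx in tj.
  by move=> /andP[jm mp] ->; exists m => //; apply/connectP; exists p.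
have [L1 s1 N1] := ccov_complete R dE iJ lJ cJ.
pose L2 : 'M[R]_n := \matrix_(x, y) (E x y)%:R.
have s2 : supported E L2 by move=> x y /negPf xy; rewrite mxE xy.
(* [L1] makes the covariance given [j] and [K] nonzero, unit weights make the effect of [m] on [t]
   positive; some point of the line does both. *)
have [||x [N0 b0]] := ratfun_generic (x := 0) (y := 1)
   (ratfun_ccov_line (j |: K) l i dE s1 s2 w0) (ratmx_toteff dE s1 s2 m t).
- by rewrite /line scale0r addr0.
- by rewrite /line scale1r addrC subrK gt_eqF // toteff_gt0.
have sL := line_supported x s1 s2.
set L := line L1 L2 x in sL N0 b0.
pose beta : 'rV[R]_n := delta_mx 0 m *m toteff L.
have bE v : beta 0 v = toteff L m v by rewrite /beta -rowE mxE.
(* A directed path from [m] to [j] would close a cycle. *)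
have bj : beta 0 j = 0 by rewrite bE (toteff_connect dE sL) // dE.
pose Lz (z : R) : 'M[R]_n := L + (z *: delta_mx j 0) *m (delta_mx 0 m : 'rV_n).
have sLz z : supported E (Lz z).
  move=> u v uv; rewrite mxE sL // add0r mxE big_ord1 !mxE !eqxx andbT /=.
  case: eqP => [eu|_]; last by rewrite mulr0 mul0r.
  case: eqP => [ev|_]; last by rewrite mulr0.
  by rewrite eu ev jm in uv.
have Sz z : covdag (Lz z) w = (shear j beta z)^T *m covdag L w *m shear j beta z.
  rewrite /Lz covdag_update //; first exact: unit_1sub dE sL.
  rewrite -/beta -scalemxAr -colE; apply/matrixP => p q.
  by rewrite !ord1 mxE [col _ _ _ _]mxE bj mulr0 mxE.
have cSz z : covmx ((shear j beta z)^T *m covdag L w *m shear j beta z).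
  by rewrite -Sz; apply: cd.
have lj : l != j by rewrite eq_sym.
have bt : beta 0 t != 0 by rewrite bE.
have [z Hz] := tuning (cd _ sL) cSz ij lj iK jK lK bj N0 tiK bt.
by exists (covdag (Lz z) w); split; [exact: gd | exact: cd | rewrite Sz].
Qed.

Theorem theorem6p1 (R : realType) (n : nat) (E : rel 'I_n) (i j l : 'I_n)
    (K : {set 'I_n}) :
  dag E ->
  i != j -> i != l -> j != l -> i \notin K -> j \notin K -> l \notin K ->
  ~ dsep E K i j -> ~ dsep E K i l ->
  ((forall delta : R, 0 <= delta <= 1 ->
      forall S : 'M[R]_n, gaussian_dag E S -> Mdelta i j K delta S ->
        Mdelta i l K delta S)
   <-> dsep E (j |: K) i l).
Proof.
move=> dE ij il jl iK jK lK _ nil.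
have iJ : i \notin j |: K by rewrite !inE negb_or ij.
have lJ : l \notin j |: K by rewrite !inE negb_or eq_sym jl.
rewrite dsep_oconn //; split=> [incl cJ|nc delta _ S gS [cS Sij]]; last first.
  split=> //; apply: le_trans Sij.
  exact: inclusion_of_oconn dE ij il jl iK jK lK nc gS cS.
have cK : oconn E K i l.
  by apply: contrapT => nc; apply: nil; apply/dsep_oconn.
have [S [gS cS]] := separating_covariance R dE ij il jl iK jK lK cK cJ.
rewrite ltNge -pcor_le // => /negP; apply.
by have [||_] := incl `|pcor S K i j| _ S gS; rewrite ?normr_ge0 ?pcor_le1.
Qed.
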